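(* A non-trapezoidal convex quadrangle admits a $3$-self-affinity of combinatorial type $\mathcal C$ if and only if it is of an affine type $Q[x,y]$ with $(x,y)$ either in the family $\mathbf C=\{(x,x^2-x+1):0<x<1\}$ or equal to one of the following 13 pairs, each being the solution in $\mathcal P$ of the indicated system with the indicated value: (1) $x^3y-xy+y^2-x-y+1=0$, $x^2y^2+x^3-y^2x-2x^2-xy-y^2+2x+2y-1=0$; $(0.54368\ldots,0.83928\ldots)$. (2) $x^3y+x^2y^2-x^2y-y^2x-x+y=0$, $x^3y+x^2y^2-x^2y-2y^2x-y^3-x^2+xy+2y^2+x-y=0$; $(0.55706\ldots,0.85490\ldots)$. (3) $x^3y+x^2y^2-x^2y+y^2x-x^2-2xy-y^2+x+y=0$, $x^3y+x^2y^2-x^3-4x^2y-y^2x+2x^2+3xy+y^2-x-y=0$; $(0.54660\ldots,0.72669\ldots)$. (4) $x^2y^2+y^3x+x^2y-y^2x-x^2-2xy-y^2+x+y=0$, $x^4+x^3y-3x^3-2x^2y-y^2x+2x^2+3xy+y^2-x-y=0$; $(0.50678\ldots,0.67567\ldots)$. (5) $x^3y+2x^2y^2+y^3x-2x^2y-3y^2x-y^3-x^2+2xy+y^2=0$, $x^3y+2x^2y^2+y^3x-x^3-3x^2y-3y^2x-y^3+2x^2+xy+y^2=0$; $\left(\frac{9-4\sqrt2}{7},\frac{10+\sqrt2}{14}\right)$. (6) $x^2y^2+y^3x-y^2x-y^3-x+y=0$, $x^2y^2+y^3x+x^3-x^2y-3y^2x-y^3-x^2+xy+2y^2+x-y=0$;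 $(0.25805\ldots,0.84781\ldots)$. (7) $x^3+x^2y-x^2+y^2-2x-2y+2=0$, $y^2x+y^3-x^2-3xy-2y^2+3x+3y-2=0$; $(0.58750\ldots,0.78257\ldots)$. (8) $x^2y+y^2x-2x^2-3xy-y^2+3x+3y-2=0$, $x^2y+y^2x-2x-2y+2=0$; $\left(\frac12,\frac{7-\sqrt{17}}{4}\right)$. (9) $x^2y+2y^2x+y^3-4xy-4y^2+x+3y=0$, $x^2+xy-y=0$; $(0.59100\ldots,0.85403\ldots)$. (10) $x^2y+y^3-2xy-2y^2+x+y=0$, $x^3+x^2y+2y^2x-2x^2-3xy-y^2+x+y=0$; $(0.41803\ldots,0.71831\ldots)$. (11) $y^3x+x^2y-y^3-xy+y^2-x-y+1=0$, $x^3y-x^2y^2-y^3x-2x^3+2y^2x+2x^2+xy+y^2-2x-2y+1=0$; $(0.33133\ldots,0.78783\ldots)$. (12) $2y^2x-2yx-2y^2+x+y=0$, $3x^2y+y^2x-2x^2-3yx-y^2+x+y=0$; $\left(\frac25,\frac23\right)$. (13) $y^4+x^2y-y^3-xy+y^2-x-y+1=0$, $x^4-x^2y^2-y^3x-2x^3+2y^2x+2x^2+xy+y^2-2x-2y+1=0$; $(0.59717\ldots,0.87586\ldots)$. All these parameters $(x,y)$ lie in $\mathcal P$.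
   Context: $\mathcal P=\{(x,y)\in\mathbb R^2: x+y>1,\ y\le1,\ x\le y\}$. A convex quadrangle is of affine type $Q[x,y]$ if an affine map sending three consecutive vertices to $\binom01,\binom00,\binom10$ sends the fourth to $\binom xy$. A trapezoid is a convex quadrangle with a pair of parallel sides. A $3$-self-affinity of $Q$ is a dissection of $Q$ into three affine images of $Q$ (union is $Q$, interiors pairwise disjoint). Combinatorial type $\mathcal C$: there is an interior point $p$ of $Q$ and three segments from $p$, one to a vertex $v$ of $Q$ and the other two to relative interior points of the two sides of $Q$ not containing $v$; the three pieces are the resulting regions. *)

(* Defs.v *)
From Stdlib Require Import Reals.
From Coquelicot Require Import Coquelicot.
Open Scope R_scope.

(** * Plane geometry *)

Notation point := (R * R)%type.
Notation region := (point -> Prop).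

Definition same_region (A B : region) : Prop := forall z, A z <-> B z.

Definition interior2 (A : region) : region := fun z => locally z A.

(* Invertible affine maps only: a degenerate image would have no interior. *)
Definition affine_map (f : point -> point) : Prop :=
  exists m11 m12 m21 m22 b1 b2 : R,
    m11 * m22 - m12 * m21 <> 0 /\
    forall z, f z = (m11 * fst z + m12 * snd z + b1,
                     m21 * fst z + m22 * snd z + b2).

Definition image (f : point -> point) (A : region) : region :=
  fun w => exists z, A z /\ w = f z.

Definition affine_image (A B : region) : Prop :=
  exists f, affine_map f /\ same_region B (image f A).

Definition between (t : R) (a b : point) : point :=
  ((1 - t) * fst a + t * fst b, (1 - t) * snd a + t * snd b).

Definition segment (a b : point) : region :=
  fun z => exists t, 0 <= t <= 1 /\ z = between t a b.

Definition open_segment (a b : point) : region :=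
  fun z => exists t, 0 < t < 1 /\ z = between t a b.

Definition hull4 (a b c d : point) : region :=
  fun z => exists s t u v,
    0 <= s /\ 0 <= t /\ 0 <= u /\ 0 <= v /\ s + t + u + v = 1 /\
    z = (s * fst a + t * fst b + u * fst c + v * fst d,
         s * snd a + t * snd b + u * snd c + v * snd d).

Definition cross (u v : point) : R := fst u * snd v - snd u * fst v.

Definition vec (a b : point) : point := (fst b - fst a, snd b - snd a).

Definition turn (a b c : point) : R := cross (vec a b) (vec b c).

(* [a], [b], [c], [d], in this cyclic order, are the vertices of a
   nondegenerate convex quadrangle: walking round, one always turns strictly
   to the same side.  Both orientations are allowed. *)
Definition convex_cycle (a b c d : point) : Prop :=
  (0 < turn a b c /\ 0 < turn b c d /\ 0 < turn c d a /\ 0 < turn d a b) \/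
  (turn a b c < 0 /\ turn b c d < 0 /\ turn c d a < 0 /\ turn d a b < 0).

Definition quadrangle_on (Q : region) (a b c d : point) : Prop :=
  convex_cycle a b c d /\ same_region Q (hull4 a b c d).

Definition convex_quadrangle (Q : region) : Prop :=
  exists a b c d, quadrangle_on Q a b c d.

(* Adjacent sides are never parallel, and the vertices may be listed from any
   starting point, so one pair of opposite sides suffices. *)
Definition trapezoid (Q : region) : Prop :=
  exists a b c d, quadrangle_on Q a b c d /\ cross (vec a b) (vec c d) = 0.

(* [Q] is of affine type Q[x,y]. *)
Definition affine_type (Q : region) (x y : R) : Prop :=
  exists a b c d f,
    quadrangle_on Q a b c d /\ affine_map f /\
    f a = (0, 1) /\ f b = (0, 0) /\ f c = (1, 0) /\ f d = (x, y).

(** * Self-affinities *)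

Definition interiors_disjoint (A B : region) : Prop :=
  forall z, ~ (interior2 A z /\ interior2 B z).

Definition self_affinity3 (Q P1 P2 P3 : region) : Prop :=
  (affine_image Q P1 /\ affine_image Q P2 /\ affine_image Q P3) /\
  (forall z, Q z <-> P1 z \/ P2 z \/ P3 z) /\
  (interiors_disjoint P1 P2 /\ interiors_disjoint P2 P3 /\
   interiors_disjoint P3 P1).

(* For [p] interior to a convex set and the broken line [a]-[b]-[c] contained
   in its boundary, this is the region bounded by the broken line and the
   segments from [p] to [a] and [c].  It need not be convex: there may be a
   reflex angle at [p]. *)
Definition sector (p a b c : point) : region :=
  fun z => exists w, (segment a b w \/ segment b c w) /\ segment p w z.

(* The segments from [p] to [v], [q], [r] split the boundary of [Q] into the
   arcs [v]-[b]-[q], [q]-[c]-[r], [r]-[d]-[v]; the pieces are the three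
   sectors over them.  Since [b] and [d] are the neighbours of [v], the sides
   not containing [v] are [b]-[c] and [c]-[d]. *)
Definition combinatorial_type_C (Q P1 P2 P3 : region) : Prop :=
  exists v b c d p q r,
    quadrangle_on Q v b c d /\ interior2 Q p /\
    open_segment b c q /\ open_segment c d r /\
    same_region P1 (sector p v b q) /\
    same_region P2 (sector p q c r) /\
    same_region P3 (sector p r d v).

Definition admits_self_affinity3_C (Q : region) : Prop :=
  exists P1 P2 P3, self_affinity3 Q P1 P2 P3 /\ combinatorial_type_C Q P1 P2 P3.

(** * Parameters *)

Definition in_P (x y : R) : Prop := x + y > 1 /\ y <= 1 /\ x <= y.

Definition family_C (x y : R) : Prop := 0 < x < 1 /\ y = x ^ 2 - x + 1.

Definition system (k : nat) (x y : R) : Prop :=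
  match k with
  | 1%nat =>
      x^3*y - x*y + y^2 - x - y + 1 = 0 /\
      x^2*y^2 + x^3 - y^2*x - 2*x^2 - x*y - y^2 + 2*x + 2*y - 1 = 0
  | 2%nat =>
      x^3*y + x^2*y^2 - x^2*y - y^2*x - x + y = 0 /\
      x^3*y + x^2*y^2 - x^2*y - 2*y^2*x - y^3 - x^2 + x*y + 2*y^2 + x - y = 0
  | 3%nat =>
      x^3*y + x^2*y^2 - x^2*y + y^2*x - x^2 - 2*x*y - y^2 + x + y = 0 /\
      x^3*y + x^2*y^2 - x^3 - 4*x^2*y - y^2*x + 2*x^2 + 3*x*y + y^2 - x - y = 0
  | 4%nat =>
      x^2*y^2 + y^3*x + x^2*y - y^2*x - x^2 - 2*x*y - y^2 + x + y = 0 /\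
      x^4 + x^3*y - 3*x^3 - 2*x^2*y - y^2*x + 2*x^2 + 3*x*y + y^2 - x - y = 0
  | 5%nat =>
      x^3*y + 2*x^2*y^2 + y^3*x - 2*x^2*y - 3*y^2*x - y^3 - x^2 + 2*x*y + y^2
        = 0 /\
      x^3*y + 2*x^2*y^2 + y^3*x - x^3 - 3*x^2*y - 3*y^2*x - y^3 + 2*x^2 + x*y
        + y^2 = 0
  | 6%nat =>
      x^2*y^2 + y^3*x - y^2*x - y^3 - x + y = 0 /\
      x^2*y^2 + y^3*x + x^3 - x^2*y - 3*y^2*x - y^3 - x^2 + x*y + 2*y^2 + x - y
        = 0
  | 7%nat =>
      x^3 + x^2*y - x^2 + y^2 - 2*x - 2*y + 2 = 0 /\
      y^2*x + y^3 - x^2 - 3*x*y - 2*y^2 + 3*x + 3*y - 2 = 0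
  | 8%nat =>
      x^2*y + y^2*x - 2*x^2 - 3*x*y - y^2 + 3*x + 3*y - 2 = 0 /\
      x^2*y + y^2*x - 2*x - 2*y + 2 = 0
  | 9%nat =>
      x^2*y + 2*y^2*x + y^3 - 4*x*y - 4*y^2 + x + 3*y = 0 /\
      x^2 + x*y - y = 0
  | 10%nat =>
      x^2*y + y^3 - 2*x*y - 2*y^2 + x + y = 0 /\
      x^3 + x^2*y + 2*y^2*x - 2*x^2 - 3*x*y - y^2 + x + y = 0
  | 11%nat =>
      y^3*x + x^2*y - y^3 - x*y + y^2 - x - y + 1 = 0 /\
      x^3*y - x^2*y^2 - y^3*x - 2*x^3 + 2*y^2*x + 2*x^2 + x*y + y^2 - 2*x - 2*y
        + 1 = 0
  | 12%nat =>
      2*y^2*x - 2*y*x - 2*y^2 + x + y = 0 /\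
      3*x^2*y + y^2*x - 2*x^2 - 3*y*x - y^2 + x + y = 0
  | 13%nat =>
      y^4 + x^2*y - y^3 - x*y + y^2 - x - y + 1 = 0 /\
      x^4 - x^2*y^2 - y^3*x - 2*x^3 + 2*y^2*x + 2*x^2 + x*y + y^2 - 2*x - 2*y
        + 1 = 0
  | _ => False
  end.

(* The decimal expansion of [x], truncated after five digits, is [d]. *)
Definition trunc5 (x d : R) : Prop := d <= x < d + 0.00001.

Definition value (k : nat) (x y : R) : Prop :=
  match k with
  | 1%nat => trunc5 x 0.54368 /\ trunc5 y 0.83928
  | 2%nat => trunc5 x 0.55706 /\ trunc5 y 0.85490
  | 3%nat => trunc5 x 0.54660 /\ trunc5 y 0.72669
  | 4%nat => trunc5 x 0.50678 /\ trunc5 y 0.67567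
  | 5%nat => x = (9 - 4 * sqrt 2) / 7 /\ y = (10 + sqrt 2) / 14
  | 6%nat => trunc5 x 0.25805 /\ trunc5 y 0.84781
  | 7%nat => trunc5 x 0.58750 /\ trunc5 y 0.78257
  | 8%nat => x = 1 / 2 /\ y = (7 - sqrt 17) / 4
  | 9%nat => trunc5 x 0.59100 /\ trunc5 y 0.85403
  | 10%nat => trunc5 x 0.41803 /\ trunc5 y 0.71831
  | 11%nat => trunc5 x 0.33133 /\ trunc5 y 0.78783
  | 12%nat => x = 2 / 5 /\ y = 2 / 3
  | 13%nat => trunc5 x 0.59717 /\ trunc5 y 0.87586
  | _ => False
  end.

Definition exceptional (k : nat) (x y : R) : Prop :=
  in_P x y /\ system k x y /\ value k x y.

Definition listed (x y : R) : Prop :=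
  family_C x y \/ exists k : nat, (1 <= k <= 13)%nat /\ exceptional k x y.

(* Main.v *)
(* Label a quadrangle by the areas of the four triangles formed by three of its
   corners.  Up to scale this vector determines the quadrangle with its labelled
   corners up to affine maps, and renaming the corners permutes it by the dihedral
   group of order 8.  So a self-affinity of type C amounts to a choice of four
   renamings, one for Q and one for each piece, such that the areas around [p] fit
   together; this leaves two polynomial equations and two inequalities in the area
   vector of Q.  If Q is no trapezoid, its vector can be sorted, [d > a >= c > b],
   and is described by [s = d - a = c - b > 0], [t = b > 0], [u = a - c >= 0]; the
   family C is [s^2 = t u].  Up to reflection all but 21 of the 8^4 choices are
   refuted by a combination of the equations and inequalities all of whose
   coefficients in [s, t, u] have the same sign (found by linear programming);
   8 of the others lead to the family and 13 to the systems.  Eliminating [y] from a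
   system leaves a univariate polynomial with a single relevant root, by Descartes'
   rule of signs, and [y] is a polynomial in this root. *)

From Stdlib Require Import Reals Lra Psatz Nsatz ZArith List Lia Bool.
From Coquelicot Require Import Coquelicot.
Require Import Defs.
Open Scope R_scope.

(** * The thirteen systems *)

(** Why two equations remain: [p], [q] and [r] together have four parameters. Each piece must match
    an area vector up to scale; as opposite entries have equal sums, these are two conditions per
    piece, six in all. The areas over the sides [b]-[c] and [c]-[d] serve as coordinates of [p].
    Four conditions then give [p], [q] and [r] explicitly, and the other two become the equations of
    [solves]. Of the bounds that place [q] and [r] inside their sides, two are automatic and two are
    the inequalities. The obstacle on the way from a dissection to its labels is that the pieces are
    known only as sets: nothing says that an affine map sends corners to corners, and a sector might
    have a straight or reflex angle at [p]. So the corners are recovered as extreme points of the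
    image, using only the three turns away from [p]; positivity of the turn at [p] is then a
    consequence of the match. *)

Fixpoint horner (l : list Z) (x : R) : R :=
  match l with
  | nil => 0
  | c :: r => IZR c + x * horner r x
  end.

Fixpoint hadd (l m : list Z) : list Z :=
  match l, m with
  | nil, _ => m
  | _, nil => l
  | a :: l', b :: m' => (a + b)%Z :: hadd l' m'
  end.

Definition hscale (c : Z) (l : list Z) : list Z := map (Z.mul c) l.

Lemma horner_add l m x : horner (hadd l m) x = horner l x + horner m x.
Proof.
  revert m; induction l as [|a l IH]; intros [|b m]; simpl; try ring.
  rewrite IH, plus_IZR; ring.
Qed.

Lemma horner_scale c l x : horner (hscale c l) x = IZR c * horner l x.
Proof.
  induction l as [|a l IH]; simpl; [ring|]. rewrite IH, mult_IZR; ring.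
Qed.

Lemma horner_continuity l : continuity (horner l).
Proof.
  induction l as [|c l IH]; simpl.
  - apply continuity_const; now intros x y.
  - apply continuity_plus; [apply continuity_const; now intros x y|].
    apply continuity_mult; [apply derivable_continuous, derivable_id | exact IH].
Qed.

(* The numerator in [z] of the polynomial at [x = (p/q) * z / (1 + z)]; the
   positive reals [z] correspond to the interval [0 < x < p/q]. *)
Fixpoint moebius (p q : Z) (l : list Z) : list Z :=
  match l with
  | nil => nil
  | c :: r =>
      hadd (hscale c (Nat.iter (length r)
                        (fun m => hscale q (hadd m (0%Z :: m))) (1%Z :: nil)))
           (0%Z :: hscale p (moebius p q r))
  end.

(** The denominators are cleared with the power [length l - 1]; the extra factor [q * (1 + z)] on
    the left avoids this truncated subtraction. *)
Lemma horner_moebius p q l z : IZR q <> 0 -> 1 + z <> 0 ->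
  IZR q * (1 + z) * horner (moebius p q l) z =
  (IZR q * (1 + z)) ^ length l * horner l (IZR p * z / (IZR q * (1 + z))).
Proof.
  intros hq hz. induction l as [|c r IH]; simpl; [ring|].
  assert (E : horner (Nat.iter (length r)
                (fun m => hscale q (hadd m (0%Z :: m))) (1%Z :: nil)) z
              = (IZR q * (1 + z)) ^ length r).
  { clear. induction (length r) as [|n IH]; simpl; [ring|].
    rewrite horner_scale, horner_add; simpl. rewrite IH; ring. }
  rewrite horner_add, horner_scale, E; simpl. rewrite horner_scale.
  transitivity (IZR q * (1 + z) * (IZR c * (IZR q * (1 + z)) ^ length r)
    + IZR p * z * (IZR q * (1 + z) * horner (moebius p q r) z)); [ring|].
  rewrite IH. field. auto.
Qed.

Fixpoint neg_then_pos (l : list Z) : bool :=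
  match l with
  | nil => true
  | c :: r => if (c <=? 0)%Z then neg_then_pos r else forallb (Z.leb 0) r
  end.

Definition one_sign_change (l : list Z) : bool :=
  match l with
  | nil => false
  | c :: r => (c <? 0)%Z && neg_then_pos r
  end.

Lemma horner_pos_mono l z z' : forallb (Z.leb 0) l = true -> 0 < z < z' ->
  0 <= horner l z <= horner l z'.
Proof.
  intros H hz. induction l as [|c r IH]; simpl in *; [lra|].
  apply andb_prop in H as [Hc Hr]. apply Z.leb_le, IZR_le in Hc.
  specialize (IH Hr). nra.
Qed.

(* If [l] changes sign after degree [k], then [z ^ -k * horner l z] is
   increasing; this is the case of one sign change in Descartes' rule. *)
Lemma neg_then_pos_mono l z z' : neg_then_pos l = true -> 0 < z < z' ->
  exists k, z' ^ k * horner l z <= z ^ k * horner l z'.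
Proof.
  intros H hz. induction l as [|c r IH]; simpl in *; [exists 0%nat; lra|].
  destruct (Z.leb_spec c 0) as [Hc|Hc].
  - destruct (IH H) as [k Hk]. exists (S k). simpl.
    apply IZR_le in Hc.
    assert (z ^ k <= z' ^ k) by (apply pow_incr; lra).
    assert (0 < z ^ k) by (apply pow_lt; lra).
    assert (z * z ^ k <= z' * z' ^ k) by nra.
    assert (z * z' * (z' ^ k * horner r z) <= z * z' * (z ^ k * horner r z'))
      by (apply Rmult_le_compat_l; nra).
    assert (IZR c * (z' * z' ^ k) <= IZR c * (z * z ^ k)) by nra.
    lra.
  - exists 0%nat. simpl. pose proof (horner_pos_mono r z z' H hz).
    apply IZR_lt in Hc. nra.
Qed.

(** Because the constant term is negative, [z ^ -(k + 1) * horner l z] is strictly increasing for a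
    suitable [k] and cannot vanish twice. Cross-multiplied powers replace the division. *)
Lemma one_sign_change_root l z z' : one_sign_change l = true -> 0 < z < z' ->
  horner l z = 0 -> horner l z' = 0 -> False.
Proof.
  destruct l as [|c r]; simpl; [discriminate|].
  intros H hz E E'. apply andb_prop in H as [Hc Hr].
  apply Z.ltb_lt, IZR_lt in Hc.
  destruct (neg_then_pos_mono r z z' Hr hz) as [k Hk].
  assert (z ^ k <= z' ^ k) by (apply pow_incr; lra).
  assert (0 < z ^ k) by (apply pow_lt; lra).
  assert (z * z ^ k < z' * z' ^ k) by nra.
  assert (z * z' * (z' ^ k * horner r z) <= z * z' * (z ^ k * horner r z'))
    by (apply Rmult_le_compat_l; nra).
  assert (IZR c * (z' * z' ^ k) < IZR c * (z * z ^ k)) by nra.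
  assert (z' * z' ^ k * (IZR c + z * horner r z) = 0) by (rewrite E; ring).
  assert (z * z ^ k * (IZR c + z' * horner r z') = 0) by (rewrite E'; ring).
  lra.
Qed.

Lemma root_unique p q l x x' : (0 < p)%Z -> (0 < q)%Z ->
  one_sign_change (moebius p q l) = true ->
  0 < x < IZR p / IZR q -> 0 < x' < IZR p / IZR q ->
  horner l x = 0 -> horner l x' = 0 -> x = x'.
Proof.
  intros hp hq. apply IZR_lt in hp, hq.
  assert (sym : forall x x', one_sign_change (moebius p q l) = true ->
    0 < x < x' -> x' < IZR p / IZR q ->
    horner l x = 0 -> horner l x' = 0 -> False).
  { clear x x'. intros x x' H hx hx' E E'.
    assert (B : forall y, y < IZR p / IZR q -> IZR q * y < IZR p).
    { intros y hy. apply (Rmult_lt_compat_l (IZR q)) in hy; [|lra].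
      replace (IZR q * (IZR p / IZR q)) with (IZR p) in hy by (field; lra). lra. }
    pose proof (B x ltac:(lra)). pose proof (B x' hx').
    (* Inverse of the substitution [y = p z / (q (1 + z))], increasing from [0 < y < p / q] onto the
       positive reals. *)
    set (Z y := IZR q * y / (IZR p - IZR q * y)).
    assert (R0 : forall y, 0 < y -> IZR q * y < IZR p -> horner l y = 0 ->
                 0 < Z y /\ horner (moebius p q l) (Z y) = 0).
    { intros y hy hy' Ey. assert (0 < Z y).
      { unfold Z. apply Rdiv_lt_0_compat; nra. }
      split; [assumption|].
      pose proof (horner_moebius p q l (Z y) ltac:(lra) ltac:(lra)) as T.
      replace (IZR p * Z y / (IZR q * (1 + Z y))) with y in T
        by (unfold Z; field; lra).
      rewrite Ey, Rmult_0_r in T. apply Rmult_integral in T as [T|T]; nra. }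
    apply (one_sign_change_root (moebius p q l) (Z x) (Z x') H).
    - split; [apply R0; auto; lra|].
      unfold Z. apply Rlt_0_minus.
      replace (_ - _) with (IZR q * IZR p * (x' - x) /
        ((IZR p - IZR q * x') * (IZR p - IZR q * x))) by (field; lra).
      apply Rdiv_lt_0_compat; apply Rmult_lt_0_compat; nra.
    - apply R0; auto; lra.
    - apply R0; auto; lra. }
  intros H hx hx' E E'.
  destruct (Rtotal_order x x') as [L|[L|L]]; [|exact L|].
  - exfalso; apply (sym x x'); tauto.
  - exfalso; apply (sym x' x); tauto.
Qed.

Definition uniquely_solvable (k : nat) : Prop :=
  exists x y, exceptional k x y /\
    forall x' y', in_P x' y' -> system k x' y' -> (x', y') <> (1, 1) ->
      x' = x /\ y' = y.

Lemma in_P_bounds x y : in_P x y -> (x, y) <> (1, 1) -> 0 < x < 1 /\ y > 0.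
Proof.
  unfold in_P. intros H N. split; [|lra]. split; [lra|].
  destruct (Req_dec x 1) as [->|]; [|lra].
  exfalso; apply N; f_equal; lra.
Qed.

(* The [x] of the solution is the root of [M] in [0 < x < p / q], isolated by
   [lo] and [hi], and [d * y = N x]. *)
Lemma uniquely_solvable_intro k (M N : list Z) (d p q : Z) (lo hi : R) :
  (0 < p)%Z -> (0 < q)%Z -> (0 < d)%Z ->
  0 < lo -> lo < hi -> hi < 1 ->
  horner M lo * horner M hi <= 0 ->
  one_sign_change (moebius p q M) = true ->
  (forall x y, lo <= x <= hi -> IZR d * y = horner N x ->
     in_P x y /\ value k x y) ->
  (forall x y, horner M x = 0 -> IZR d * y = horner N x -> system k x y) ->
  (forall x y, system k x y -> 0 < x < 1 -> y <= 1 ->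
     horner M x = 0 /\ IZR d * y = horner N x /\ x < IZR p / IZR q) ->
  uniquely_solvable k.
Proof.
  intros hp hq hd hlo hlh hhi Hsg Hsc Hv Hs Hu.
  destruct (IVT_cor (horner M) lo hi (horner_continuity M) ltac:(lra) Hsg)
    as (x & hx & Mx).
  apply IZR_lt in hd.
  assert (Ey : IZR d * (horner N x / IZR d) = horner N x) by (field; lra).
  set (y := horner N x / IZR d) in *.
  destruct (Hv x y hx Ey) as [HP HV].
  pose proof (Hs x y Mx Ey) as S.
  destruct (Hu x y S ltac:(lra) (proj1 (proj2 HP))) as (_ & _ & hpq).
  exists x, y. split; [exact (conj HP (conj S HV))|].
  intros x' y' HP' S' N1.
  destruct (in_P_bounds x' y' HP' N1) as [hx' _].
  destruct (Hu x' y' S' hx' (proj1 (proj2 HP'))) as (Mx' & Ey' & hpq').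
  assert (x' = x) as -> by (apply (root_unique p q M); auto; lra).
  split; [reflexivity|]. apply (Rmult_eq_reg_l (IZR d)); lra.
Qed.

(* [nsatz] fails on powers, on negative numerals and on zero terms. *)
Ltac poly_unfold :=
  cbn [horner pow] in *;
  repeat match goal with
  | |- context [IZR (Zneg ?p)] =>
      change (IZR (Zneg p)) with (- IZR (Zpos p))
  | H : context [IZR (Zneg ?p)] |- _ =>
      change (IZR (Zneg p)) with (- IZR (Zpos p)) in H
  end;
  rewrite ?Rmult_0_r, ?Rplus_0_r, ?Rplus_0_l, ?Rmult_1_r in *.

Ltac power_bounds x lo hi n :=
  match n with
  | 0%nat => idtac
  | S ?m => pose proof (pow_incr lo x n ltac:(lra));
            pose proof (pow_incr x hi n ltac:(lra)); power_bounds x lo hi m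
  end.

(** The quartic is a cofactor in the eliminations for system 11 and has to be cancelled there. *)
Lemma quartic_factor_nonzero x : 0 < x < 1 -> x ^ 4 - 2 * x ^ 2 - 1 <> 0.
Proof.
  intros hx. assert (x ^ 2 < 1) by nra.
  replace (x ^ 4 - 2 * x ^ 2 - 1) with (x ^ 2 * (x ^ 2 - 2) - 1) by ring. nra.
Qed.

Ltac cancel H :=
  apply Rmult_integral in H as [H|H];
  [ exfalso; revert H;
    repeat (apply Rmult_integral_contrapositive_currified || apply pow_nonzero);
    first [apply quartic_factor_nonzero; assumption | nra]
  | exact H ].

(* [w1 * M] and [w2 * (d * y - N)] lie in the ideal of the system, and the
   factors [w1], [w2] have no zero with [0 < x < 1]. *)
Ltac solve_system k M N d p q lo hi w1 w2 :=
  apply (uniquely_solvable_intro k M N d p q lo hi); try reflexivity; try lra;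
  [ cbn [horner]; nra
  | let x := fresh "x" in let y := fresh "y" in
    let hx := fresh "hx" in let E := fresh "E" in
    intros x y hx E; cbn [horner] in E;
    let n := eval compute in (length N) in power_bounds x lo hi n;
    unfold in_P, value, trunc5; lra
  | let x := fresh "x" in let y := fresh "y" in
    let E := fresh "E" in let E' := fresh "E" in
    intros x y E E'; unfold system; poly_unfold; split; nsatz
  | let x := fresh "x" in let y := fresh "y" in
    let E1 := fresh "E" in let E2 := fresh "E" in
    let hx := fresh "hx" in let hy := fresh "hy" in
    let T := fresh "T" in let EM := fresh "EM" in let EN := fresh "EN" in
    let h := fresh "h" in let le := fresh "le" in
    intros x y [E1 E2] hx hy;
    let e1 := eval cbv beta in (w1 x) in
    let e2 := eval cbv beta in (w2 x) in
    assert (EM : horner M x = 0)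
      by (assert (T : e1 * horner M x = 0) by (clear hx hy; poly_unfold; nsatz);
          cancel T);
    assert (EN : IZR d * y - horner N x = 0)
      by (assert (T : e2 * (IZR d * y - horner N x) = 0)
            by (clear hx hy EM; poly_unfold; nsatz);
          cancel T);
    split; [exact EM|split; [lra|]];
    clear E1 E2 EM; cbn [horner] in EN; apply Rnot_le_lt; intros le;
    remember (x - IZR p / IZR q) as h;
    replace x with (IZR p / IZR q + h) in EN by lra; nra ].

Lemma system1_solvable : uniquely_solvable 1.
Proof.
  solve_system 1%nat
    ((-1) :: 1 :: (-1) :: 3 :: 3 :: 1 :: (-1) :: (-1) :: nil)%Z
    (1 :: (-1) :: 3 :: 2 :: 1 :: (-1) :: (-1) :: nil)%Z
    2%Z 1%Z 1%Z (54368901 / 100000000) (54368902 / 100000000)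
    (fun x : R => (x - 1) ^ 3) (fun x : R => (x - 1) ^ 3).
Qed.

Lemma system2_solvable : uniquely_solvable 2.
Proof.
  solve_system 2%nat
    ((-1) :: 4 :: (-8) :: 11 :: (-10) :: 7 :: (-2) :: nil)%Z
    (0 :: 2 :: (-3) :: 5 :: (-2) :: nil)%Z
    1%Z 1%Z 1%Z (55706179 / 100000000) (55706180 / 100000000)
    (fun x : R => x ^ 2 * (x - 1)) (fun x : R => x ^ 2 * (x - 1)).
Qed.

Lemma system3_solvable : uniquely_solvable 3.
Proof.
  solve_system 3%nat
    ((-2) :: 5 :: (-3) :: 1 :: nil)%Z
    (2 :: (-1) :: nil)%Z
    2%Z 1%Z 1%Z (54660234 / 100000000) (54660235 / 100000000)
    (fun x : R => x ^ 3 * (x - 1)) (fun x : R => x ^ 3 * (x - 1) ^ 2).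
Qed.

Lemma system4_solvable : uniquely_solvable 4.
Proof.
  solve_system 4%nat
    ((-2) :: 7 :: (-10) :: 11 :: (-8) :: 4 :: (-1) :: nil)%Z
    (2 :: (-4) :: 4 :: (-3) :: 1 :: nil)%Z
    1%Z 1%Z 1%Z (50678503 / 100000000) (50678504 / 100000000)
    (fun x : R => x ^ 3 * (x - 1)) (fun x : R => x ^ 3 * (x - 1) ^ 2).
Qed.

Lemma system6_solvable : uniquely_solvable 6.
Proof.
  solve_system 6%nat
    ((-1) :: 4 :: (-1) :: 2 :: nil)%Z
    (3 :: 1 :: 2 :: nil)%Z
    4%Z 1%Z 1%Z (25805587 / 100000000) (25805588 / 100000000)
    (fun x : R => x ^ 2 * (x - 1)) (fun x : R => x ^ 3 * (x - 1) ^ 2).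
Qed.

Lemma system7_solvable : uniquely_solvable 7.
Proof.
  solve_system 7%nat
    ((-1) :: 0 :: 3 :: 1 :: (-2) :: nil)%Z
    (2 :: (-1) :: (-3) :: 2 :: nil)%Z
    1%Z 1%Z 1%Z (58750599 / 100000000) (58750600 / 100000000)
    (fun x : R => (x - 1)) (fun x : R => (x - 1) ^ 2).
Qed.

(** In systems 9, 10 and 11 the polynomial [M] is negative at 0 and equal to -1 at 1, so it has a
    second root below 1. There [N] would give [y > 1]; the bound [p / q] separates the two roots and
    follows from [y <= 1]. *)
Lemma system9_solvable : uniquely_solvable 9.
Proof.
  solve_system 9%nat
    ((-1) :: 0 :: 7 :: (-7) :: nil)%Z
    ((-1) :: (-1) :: 7 :: nil)%Z
    1%Z 147%Z 200%Z (59100904 / 100000000) (59100905 / 100000000)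
    (fun x : R => x) (fun x : R => x).
Qed.

Lemma system10_solvable : uniquely_solvable 10.
Proof.
  solve_system 10%nat
    ((-2) :: 9 :: (-12) :: 5 :: (-1) :: nil)%Z
    ((-2) :: 8 :: (-4) :: 1 :: nil)%Z
    1%Z 3%Z 5%Z (41803341 / 100000000) (41803342 / 100000000)
    (fun x : R => x ^ 3 * (x - 1)) (fun x : R => x ^ 3 * (x - 1) ^ 2).
Qed.

Lemma system11_solvable : uniquely_solvable 11.
Proof.
  solve_system 11%nat
    ((-1) :: 7 :: (-18) :: 21 :: (-9) :: 1 :: (-2) :: nil)%Z
    ((-1) :: 51 :: (-127) :: 93 :: 8 :: 20 :: nil)%Z
    7%Z 3%Z 4%Z (33133094 / 100000000) (33133095 / 100000000)
    (fun x : R => x ^ 2 * (x - 1) * (x ^ 4 - 2 * x ^ 2 - 1))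
    (fun x : R => x ^ 2 * (x - 1) ^ 2 * (x ^ 4 - 2 * x ^ 2 - 1)).
Qed.

Lemma system13_solvable : uniquely_solvable 13.
Proof.
  solve_system 13%nat
    ((-1) :: 6 :: (-18) :: 31 :: (-37) :: 36 :: (-20) :: 5 :: (-2) :: 1 :: nil)%Z
    (2238 :: (-6977) :: 13001 :: (-14684) :: 15497 :: (-9530) :: 2234 ::
     (-874) :: 498 :: nil)%Z
    1043%Z 1%Z 1%Z (59717288 / 100000000) (59717289 / 100000000)
    (fun x : R => (x - 1) ^ 2 * (x ^ 2 + 1) ^ 2)
    (fun x : R => (x - 1) ^ 3 * (x ^ 2 + 1) ^ 2).
Qed.

(** Here the value is exact, so numerical bounds do not suffice. Elimination gives
    [7 - 18 x + 7 x ^ 2], with roots [(9 ± 4 sqrt 2) / 7], the larger one above 1. *)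
Lemma system5_solvable : uniquely_solvable 5.
Proof.
  pose proof (sqrt_sqrt 2 ltac:(lra)) as h2. pose proof (sqrt_pos 2) as p2.
  assert (1.414 < sqrt 2 < 1.415) as b2 by (split; nra).
  exists ((9 - 4 * sqrt 2) / 7), ((10 + sqrt 2) / 14). split.
  - split; [unfold in_P; lra|split; [|split; reflexivity]].
    unfold system. remember (sqrt 2) as r.
    assert (7 * ((9 - 4 * r) / 7) = 9 - 4 * r) as Ex by field.
    assert (14 * ((10 + r) / 14) = 10 + r) as Ey by field.
    remember ((9 - 4 * r) / 7) as x. remember ((10 + r) / 14) as y.
    clear - h2 Ex Ey. poly_unfold. split; nsatz.
  - intros x y HP [E1 E2] N.
    destruct (in_P_bounds x y HP N) as [hx _].
    assert (7 - 18 * x + 7 * x ^ 2 = 0) as EM.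
    { assert (T : x ^ 3 * (x - 1) * (7 - 18 * x + 7 * x ^ 2) = 0)
        by (clear - E1 E2; poly_unfold; nsatz).
      cancel T. }
    assert (8 * y - 7 + x = 0) as EN.
    { assert (T : x ^ 3 * (x - 1) ^ 2 * (8 * y - 7 + x) = 0)
        by (clear - E1 E2; poly_unfold; nsatz).
      cancel T. }
    assert (7 * x - 9 + 4 * sqrt 2 = 0) as Ex.
    { assert (T : (7 * x - 9 - 4 * sqrt 2) * (7 * x - 9 + 4 * sqrt 2) = 0)
        by nra.
      cancel T. }
    split; lra.
Qed.

(** In this system [x] is rational and [y] is not, so [y] is no rational polynomial in [x]. At
    [x = 1/2] the equations reduce to [2 y ^ 2 - 7 y + 4 = 0], whose other root exceeds 1. *)
Lemma system8_solvable : uniquely_solvable 8.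
Proof.
  pose proof (sqrt_sqrt 17 ltac:(lra)) as h17. pose proof (sqrt_pos 17) as p17.
  assert (4.1 < sqrt 17 < 4.2) as b17 by (split; nra).
  exists (1 / 2), ((7 - sqrt 17) / 4). split.
  - split; [unfold in_P; lra|split; [|split; reflexivity]].
    unfold system. split; nra.
  - intros x y HP [E1 E2] N.
    destruct (in_P_bounds x y HP N) as [hx _].
    assert (2 * x - 1 = 0) as EM.
    { assert (T : x * (x - 1) * (2 * x - 1) = 0)
        by (clear - E1 E2; poly_unfold; nsatz).
      cancel T. }
    assert (x = 1 / 2) as -> by lra.
    split; [reflexivity|]. unfold in_P in HP.
    assert (4 * y - 7 + sqrt 17 = 0) as Ey.
    { assert (T : (4 * y - 7 - sqrt 17) * (4 * y - 7 + sqrt 17) = 0) by nra.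
      cancel T. }
    lra.
Qed.

Lemma system12_solvable : uniquely_solvable 12.
Proof.
  exists (2 / 5), (2 / 3). split.
  - split; [unfold in_P; lra|split; [|split; reflexivity]].
    unfold system. split; lra.
  - intros x y HP [E1 E2] N.
    destruct (in_P_bounds x y HP N) as [hx hy].
    assert (2 - 5 * x = 0) as EM.
    { assert (T : x ^ 3 * (x - 1) * (2 - 5 * x) = 0)
        by (clear - E1 E2; poly_unfold; nsatz).
      cancel T. }
    assert (x = 2 / 5) as -> by lra.
    split; [reflexivity|].
    assert (3 * y - 2 = 0) as Ey.
    { assert (T : (2 * y + 1) * (3 * y - 2) = 0) by nra. cancel T. }
    lra.
Qed.

Lemma systems_solvable k : (1 <= k <= 13)%nat -> uniquely_solvable k.
Proof.
  intros hk.
  do 14 (destruct k as [|k]; [first [lia | auto using system1_solvable,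
    system2_solvable, system3_solvable, system4_solvable, system5_solvable,
    system6_solvable, system7_solvable, system8_solvable, system9_solvable,
    system10_solvable, system11_solvable, system12_solvable,
    system13_solvable]|]).
  lia.
Qed.

(** * Area vectors and labels *)

Definition quad (T : Type) : Type := (T * T * T * T)%type.

(* The dihedral group of the square, acting on the corners of a quadrangle. *)
Definition relabel {T} (i : nat) (w : quad T) : quad T :=
  let '(a, b, c, d) := w in
  match i with
  | 0 => (a, b, c, d) | 1 => (b, c, d, a) | 2 => (c, d, a, b) | 3 => (d, a, b, c)
  | 4 => (a, d, c, b) | 5 => (b, a, d, c) | 6 => (c, b, a, d) | _ => (d, c, b, a)
  end%nat.

(** Group law in the numbering of [relabel]: 0 to 3 are the rotations, 4 to 7 the reflections. *)
Definition compose (i j : nat) : nat :=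
  if (i <? 4)%nat then
    if (j <? 4)%nat then (i + j) mod 4 else (j + 4 - i) mod 4 + 4
  else
    if (j <? 4)%nat then (i + j) mod 4 + 4 else (j + 4 - i) mod 4.

Lemma relabel_compose {T} i j (w : quad T) : (i < 8)%nat -> (j < 8)%nat ->
  relabel i (relabel j w) = relabel (compose i j) w.
Proof.
  intros hi hj. destruct w as [[[a b] c] d].
  do 8 (destruct i as [|i]; [do 8 (destruct j as [|j]; [reflexivity|]); lia|]).
  lia.
Qed.

Lemma compose_lt i j : (compose i j < 8)%nat.
Proof.
  unfold compose.
  pose proof (Nat.mod_upper_bound (i + j) 4 ltac:(lia)).
  pose proof (Nat.mod_upper_bound (j + 4 - i) 4 ltac:(lia)).
  destruct (i <? 4)%nat, (j <? 4)%nat; lia.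
Qed.

Lemma relabel_inverse i : (i < 8)%nat -> exists j, (j < 8)%nat /\
  forall T (u : quad T), relabel j (relabel i u) = u /\ relabel i (relabel j u) = u.
Proof.
  intros hi. exists (if (i <? 4)%nat then (4 - i) mod 4 else i)%nat.
  do 8 (destruct i as [|i];
    [split; [cbn; lia|intros T [[[? ?] ?] ?]; split; reflexivity]|]). lia.
Qed.

(* For a dissection of the quadrangle [v, b, c, d] with area vector [A] into pieces
   [v, b, q, p], [q, c, r, p], [r, d, v, p] with area vectors proportional to [al],
   [be], [ga]: [closing = 0] means that the positions of [q] on [b]-[c] forced by
   the first and by the second piece agree, and [margin > 0] that this position is
   not beyond [b].  For [r], exchange the roles of [b] and [d]. *)
Definition closing_gen {T} (add sub mul : T -> T -> T) (A al be ga : quad T) : T :=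
  let '(Av, Ab, _, _) := A in
  let '(av, _, aq, ap) := al in
  let '(bq, _, _, bp) := be in
  let '(_, _, gv, gp) := ga in
  sub (add (sub (mul (mul ap bq) (sub (mul Av gp) (mul Ab gv)))
                (mul (mul av (sub Av Ab)) (mul gp bq)))
           (mul (mul Ab gv) (mul bp aq)))
      (mul (mul Av gp) (mul aq bq)).

Definition margin_gen {T} (sub mul : T -> T -> T) (A be ga : quad T) : T :=
  let '(Av, Ab, _, _) := A in
  let '(bq, _, _, bp) := be in
  let '(_, _, gv, gp) := ga in
  sub (mul (mul Av gp) bq) (mul (mul Ab gv) bp).

(** The ring operations are parameters so that one formula serves both for real numbers and for the
    term lists on which the certificates are computed. *)
Definition closing := closing_gen Rplus Rminus Rmult.
Definition margin := margin_gen Rminus Rmult.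

(** The second and fourth conditions are the first and third for the reflected dissection:
    [relabel 4] exchanges [b] and [d], while [relabel 6] reverses a piece and keeps its corner [p]
    last. *)
Definition solves (A al be ga : quad R) : Prop :=
  closing A al be ga = 0 /\
  closing (relabel 4 A) (relabel 6 ga) (relabel 6 be) (relabel 6 al) = 0 /\
  0 < margin A be ga /\
  0 < margin (relabel 4 A) (relabel 6 be) (relabel 6 al).

Lemma solves_mirror A al be ga : solves A al be ga ->
  solves (relabel 4 A) (relabel 6 ga) (relabel 6 be) (relabel 6 al).
Proof.
  unfold solves.
  destruct A as [[[? ?] ?] ?], al as [[[? ?] ?] ?], be as [[[? ?] ?] ?],
    ga as [[[? ?] ?] ?]; cbn [relabel]. tauto.
Qed.

Definition scale (k : R) (w : quad R) : quad R :=
  let '(a, b, c, d) := w in (k * a, k * b, k * c, k * d).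

Lemma relabel_scale i k w : relabel i (scale k w) = scale k (relabel i w).
Proof.
  destruct w as [[[a b] c] d].
  do 8 (destruct i as [|i]; [reflexivity|]). reflexivity.
Qed.

(** [closing] and [margin] are homogeneous of degree one in each of their vectors, so only the
    classes up to positive scaling matter. *)
Lemma solves_scale k k1 k2 k3 A al be ga : 0 < k -> 0 < k1 -> 0 < k2 -> 0 < k3 ->
  solves (scale k A) (scale k1 al) (scale k2 be) (scale k3 ga) <->
  solves A al be ga.
Proof.
  intros h h1 h2 h3.
  assert (C : forall k k1 k2 k3 A al be ga,
    closing (scale k A) (scale k1 al) (scale k2 be) (scale k3 ga) =
    k * k1 * k2 * k3 * closing A al be ga).
  { clear. intros.
    destruct A as [[[? ?] ?] ?], al as [[[? ?] ?] ?], be as [[[? ?] ?] ?],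
      ga as [[[? ?] ?] ?]; cbn; ring. }
  assert (M : forall k k2 k3 A be ga,
    margin (scale k A) (scale k2 be) (scale k3 ga) = k * k2 * k3 * margin A be ga).
  { clear. intros.
    destruct A as [[[? ?] ?] ?], be as [[[? ?] ?] ?],
      ga as [[[? ?] ?] ?]; cbn; ring. }
  unfold solves. rewrite !relabel_scale, !C, !M.
  assert (Z : forall p x, 0 < p -> (p * x = 0 <-> x = 0)) by (intros; split; nra).
  assert (P : forall p x, 0 < p -> (0 < p * x <-> 0 < x)) by (intros; split; nra).
  rewrite !Z, !P by (repeat apply Rmult_lt_0_compat; assumption). tauto.
Qed.

(** * Polynomials in three variables, as lists of terms *)

Definition term : Type := (Z * (nat * nat * nat))%type.
Definition poly : Type := list term.

Definition same_exponents (m n : nat * nat * nat) : bool :=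
  let '(i, j, k) := m in let '(i', j', k') := n in
  ((i =? i') && (j =? j') && (k =? k'))%nat.

Fixpoint add_term (m : term) (p : poly) : poly :=
  match p with
  | nil => m :: nil
  | n :: r => if same_exponents (snd m) (snd n)
              then ((fst m + fst n)%Z, snd n) :: r else n :: add_term m r
  end.

Definition padd (p q : poly) : poly := fold_right add_term q p.

Definition popp (p : poly) : poly :=
  map (fun m : term => ((- fst m)%Z, snd m)) p.

Definition psub (p q : poly) : poly := padd p (popp q).

Definition mul_term (m n : term) : term :=
  let '(c, (i, j, k)) := m in let '(c', (i', j', k')) := n in
  ((c * c')%Z, (i + i', j + j', k + k')%nat).

Definition pmul (p q : poly) : poly :=
  fold_right (fun m acc => padd (map (mul_term m) q) acc) nil p.

Definition cst (c : Z) : poly := (c, (0, 0, 0)%nat) :: nil.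

Definition drop_zeros (p : poly) : poly :=
  filter (fun m : term => negb (fst m =? 0)%Z) p.

Definition lin (a b c : Z) : poly := drop_zeros
  ((a, (1, 0, 0)%nat) :: (b, (0, 1, 0)%nat) :: (c, (0, 0, 1)%nat) :: nil).

Definition qua (a b c d e f : Z) : poly := drop_zeros
  ((a, (2, 0, 0)%nat) :: (b, (1, 1, 0)%nat) :: (c, (1, 0, 1)%nat) ::
  (d, (0, 2, 0)%nat) :: (e, (0, 1, 1)%nat) :: (f, (0, 0, 2)%nat) :: nil).

Definition value_term (s t u : R) (m : term) : R :=
  let '(c, (i, j, k)) := m in IZR c * (s ^ i * t ^ j * u ^ k).

Definition pvalue (s t u : R) (p : poly) : R :=
  fold_right (fun m acc => value_term s t u m + acc) 0 p.

Lemma pvalue_add_term s t u m p :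
  pvalue s t u (add_term m p) = value_term s t u m + pvalue s t u p.
Proof.
  induction p as [|n r IH]; [reflexivity|]. simpl.
  destruct m as [c [[i j] k]], n as [c' [[i' j'] k']]; simpl.
  destruct (((i =? i') && (j =? j') && (k =? k'))%nat) eqn:E; simpl.
  - apply andb_prop in E as [E E3]. apply andb_prop in E as [E1 E2].
    apply Nat.eqb_eq in E1, E2, E3; subst. rewrite plus_IZR; ring.
  - simpl in IH. rewrite IH; ring.
Qed.

Lemma pvalue_add s t u p q :
  pvalue s t u (padd p q) = pvalue s t u p + pvalue s t u q.
Proof.
  induction p as [|m p IH]; simpl; [ring|].
  rewrite pvalue_add_term, IH; ring.
Qed.

Lemma pvalue_sub s t u p q :
  pvalue s t u (psub p q) = pvalue s t u p - pvalue s t u q.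
Proof.
  unfold psub. rewrite pvalue_add.
  assert (E : pvalue s t u (popp q) = - pvalue s t u q).
  { induction q as [|[c [[i j] k]] q IH]; simpl; [ring|].
    rewrite IH, opp_IZR; ring. }
  rewrite E; ring.
Qed.

Lemma pvalue_mul s t u p q :
  pvalue s t u (pmul p q) = pvalue s t u p * pvalue s t u q.
Proof.
  assert (E : forall m, pvalue s t u (map (mul_term m) q) =
                        value_term s t u m * pvalue s t u q).
  { intros [c [[i j] k]]. induction q as [|[c' [[i' j'] k']] q IH]; simpl; [ring|].
    rewrite IH, mult_IZR, !pow_add; simpl; ring. }
  induction p as [|m p IH]; simpl; [ring|].
  rewrite pvalue_add, E, IH; ring.
Qed.

Definition quad_value (s t u : R) (w : quad poly) : quad R :=
  let '(a, b, c, d) := w in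
  (pvalue s t u a, pvalue s t u b, pvalue s t u c, pvalue s t u d).

Lemma quad_value_relabel s t u i w :
  quad_value s t u (relabel i w) = relabel i (quad_value s t u w).
Proof.
  destruct w as [[[a b] c] d].
  do 8 (destruct i as [|i]; [reflexivity|]). reflexivity.
Qed.

Lemma pvalue_closing s t u A al be ga :
  pvalue s t u (closing_gen padd psub pmul A al be ga) =
  closing (quad_value s t u A) (quad_value s t u al) (quad_value s t u be)
    (quad_value s t u ga).
Proof.
  destruct A as [[[? ?] ?] ?], al as [[[? ?] ?] ?], be as [[[? ?] ?] ?],
    ga as [[[? ?] ?] ?]; cbn [closing_gen quad_value].
  repeat (rewrite pvalue_sub || rewrite pvalue_add || rewrite pvalue_mul).
  reflexivity.
Qed.

Lemma pvalue_margin s t u A be ga :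
  pvalue s t u (margin_gen psub pmul A be ga) =
  margin (quad_value s t u A) (quad_value s t u be) (quad_value s t u ga).
Proof.
  destruct A as [[[? ?] ?] ?], be as [[[? ?] ?] ?],
    ga as [[[? ?] ?] ?]; cbn [margin_gen quad_value].
  repeat (rewrite pvalue_sub || rewrite pvalue_mul). reflexivity.
Qed.

Definition coefficients_nonneg (p : poly) : bool :=
  forallb (fun m : term => (0 <=? fst m)%Z) p.

(** Since [u = 0] is allowed, only a monomial free of [u] is sure to be strictly positive. *)
Definition some_positive_without_u (p : poly) : bool :=
  existsb (fun m : term => ((0 <? fst m)%Z && (snd (snd m) =? 0)%nat)) p.

Lemma pvalue_nonneg s t u p : 0 < s -> 0 < t -> 0 <= u ->
  coefficients_nonneg p = true -> 0 <= pvalue s t u p.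
Proof.
  intros hs ht hu. induction p as [|[c [[i j] k]] p IH]; simpl; [lra|].
  intros H; apply andb_prop in H as [H1 H2].
  apply Z.leb_le, IZR_le in H1. specialize (IH H2).
  pose proof (pow_lt s i hs). pose proof (pow_lt t j ht).
  pose proof (pow_le u k hu).
  assert (0 <= s ^ i * t ^ j * u ^ k) by (apply Rmult_le_pos; nra). nra.
Qed.

Lemma pvalue_pos s t u p : 0 < s -> 0 < t -> 0 <= u ->
  coefficients_nonneg p = true ->
  some_positive_without_u p = true -> 0 < pvalue s t u p.
Proof.
  intros hs ht hu. induction p as [|[c [[i j] k]] p IH]; simpl; [discriminate|].
  intros H G; apply andb_prop in H as [H1 H2].
  pose proof (pvalue_nonneg s t u p hs ht hu H2). apply Z.leb_le, IZR_le in H1.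
  pose proof (pow_lt s i hs). pose proof (pow_lt t j ht).
  pose proof (pow_le u k hu).
  apply orb_prop in G as [G|G].
  - apply andb_prop in G as [G1 G2]. apply Nat.eqb_eq in G2; subst k.
    apply Z.ltb_lt, IZR_lt in G1. simpl.
    assert (0 < s ^ i * t ^ j) by nra. nra.
  - specialize (IH H2 G).
    assert (0 <= s ^ i * t ^ j * u ^ k) by (apply Rmult_le_pos; nra). nra.
Qed.

(* A Positivstellensatz certificate: [m1 F1 + m2 F2 + n1 I1 + n2 I2] has no
   positive coefficient although [F1 = F2 = 0 < I1, I2] and [n1, n2 >= 0]. *)
Definition refutes (F1 F2 I1 I2 : poly) (c : quad poly) : bool :=
  let '(m1, m2, n1, n2) := c in
  let r := popp (padd (padd (pmul m1 F1) (pmul m2 F2))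
                      (padd (pmul n1 I1) (pmul n2 I2))) in
  coefficients_nonneg n1 && coefficients_nonneg n2 && coefficients_nonneg r &&
  (some_positive_without_u n1 || some_positive_without_u n2
   || some_positive_without_u r).

Lemma refutes_sound s t u F1 F2 I1 I2 c : 0 < s -> 0 < t -> 0 <= u ->
  refutes F1 F2 I1 I2 c = true ->
  pvalue s t u F1 = 0 -> pvalue s t u F2 = 0 ->
  0 < pvalue s t u I1 -> 0 < pvalue s t u I2 -> False.
Proof.
  intros hs ht hu. destruct c as [[[m1 m2] n1] n2]. unfold refutes.
  set (r := popp _).
  intros H Z1 Z2 P1 P2. apply andb_prop in H as [H H4].
  apply andb_prop in H as [H H3]. apply andb_prop in H as [H1 H2].
  assert (E : pvalue s t u r = - (pvalue s t u n1 * pvalue s t u I1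
                                  + pvalue s t u n2 * pvalue s t u I2)).
  { assert (N : forall p, pvalue s t u (popp p) = 0 - pvalue s t u p).
    { intros p. change (popp p) with (psub nil p). rewrite pvalue_sub.
      reflexivity. }
    unfold r. rewrite N, !pvalue_add, !pvalue_mul, Z1, Z2; ring. }
  pose proof (pvalue_nonneg s t u _ hs ht hu H1).
  pose proof (pvalue_nonneg s t u _ hs ht hu H2).
  pose proof (pvalue_nonneg s t u _ hs ht hu H3).
  apply orb_prop in H4 as [H4|H4]; [apply orb_prop in H4 as [H4|H4]|];
    apply (pvalue_pos s t u) in H4; trivial; nra.
Qed.
(* The vector [(a, b, c, d)] with [s = d - a = c - b], [t = b], [u = a - c]. *)
Definition vertices : quad poly := (lin 1 1 1, lin 0 1 0, lin 1 1 0, lin 2 1 1).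

(** * The check of all labels *)

Definition label : Type := quad nat.

(* [existsb], but evaluated lazily by [vm_compute]. *)
Fixpoint first_of {T} (f : T -> bool) (l : list T) : bool :=
  match l with
  | nil => false
  | x :: r => if f x then true else first_of f r
  end.

Lemma first_of_exists {T} (f : T -> bool) l : first_of f l = true ->
  exists x, In x l /\ f x = true.
Proof.
  induction l as [|x l IH]; simpl; [discriminate|].
  destruct (f x) eqn:E; [eauto|]. intros H; destruct (IH H) as (y & ? & ?); eauto.
Qed.

(** A margin without positive coefficients is the cheapest contradiction; it is tested before the
    closing polynomials are expanded. *)
Definition refuted (cs : list (quad poly)) (l : label) : bool :=
  let '(g0, g1, g2, g3) := l in
  let A := relabel g0 vertices in let al := relabel g1 vertices in
  let be := relabel g2 vertices in let ga := relabel g3 vertices in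
  let A' := relabel 4 A in let al' := relabel 6 al in
  let be' := relabel 6 be in let ga' := relabel 6 ga in
  let I1 := margin_gen psub pmul A be ga in
  let I2 := margin_gen psub pmul A' be' al' in
  if coefficients_nonneg (popp I1) then true
  else if coefficients_nonneg (popp I2) then true
  else
    let F1 := closing_gen padd psub pmul A al be ga in
    let F2 := closing_gen padd psub pmul A' ga' be' al' in
    first_of (refutes F1 F2 I1 I2) cs.

Lemma refuted_sound s t u cs g0 g1 g2 g3 : 0 < s -> 0 < t -> 0 <= u ->
  refuted cs (g0, g1, g2, g3) = true ->
  let w := (s + t + u, t, s + t, 2 * s + t + u) in
  ~ solves (relabel g0 w) (relabel g1 w) (relabel g2 w) (relabel g3 w).
Proof.
  intros hs ht hu H w (Z1 & Z2 & P1 & P2).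
  assert (W : w = quad_value s t u vertices).
  { unfold w; simpl. f_equal; [f_equal; [f_equal|]|]; ring. }
  rewrite W in Z1, Z2, P1, P2. clear w W.
  repeat match goal with
  | T : context [relabel _ (quad_value _ _ _ _)] |- _ =>
      rewrite <- quad_value_relabel in T
  end.
  rewrite <- pvalue_closing in Z1, Z2. rewrite <- pvalue_margin in P1, P2.
  assert (N : forall p, coefficients_nonneg (popp p) = true ->
                        pvalue s t u p <= 0).
  { intros p Hp. apply (pvalue_nonneg s t u) in Hp; trivial.
    change (popp p) with (psub nil p) in Hp.
    rewrite pvalue_sub in Hp. simpl in Hp. lra. }
  unfold refuted in H; cbv zeta in H.
  destruct (coefficients_nonneg _) eqn:H1 in H; [apply N in H1; lra|].
  destruct (coefficients_nonneg _) eqn:H2 in H; [apply N in H2; lra|].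
  apply first_of_exists in H as (c & _ & H).
  exact (refutes_sound s t u _ _ _ _ c hs ht hu H Z1 Z2 P1 P2).
Qed.

(** Multipliers [(m1, m2, n1, n2)] of degree at most two. One short list serves all labels:
    [refuted] searches it, so no label needs a certificate of its own. *)
Definition certificates : list (quad poly) :=
  ((nil, nil, (cst 1), nil) ::
   (nil, nil, nil, (cst 1)) ::
   ((cst 1), nil, nil, nil) ::
   ((cst (-1)), nil, nil, nil) ::
   (nil, (cst 1), nil, nil) ::
   (nil, (cst (-1)), nil, nil) ::
   ((cst 1), nil, (lin 2 1 1), (lin 1 0 0)) ::
   ((lin (-3) (-1) (-2)), (lin 0 1 0), (qua 0 0 2 0 0 1), nil) ::
   ((cst 1), (cst (-1)), nil, nil) ::
   ((lin (-1) (-1) 0), (lin 0 (-1) 1), nil, (qua 0 0 1 0 0 1)) ::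
   ((lin (-1) (-2) 0), (lin 1 2 2), (qua 0 0 0 0 1 0), (qua 0 5 1 3 3 0)) ::
   (nil, (cst 1), nil, (lin 1 0 1)) ::
   (nil, nil, (cst 1), (cst 1)) ::
   ((lin 0 (-1) 0), (lin 0 1 0), (qua 2 0 2 0 0 1), (qua 0 0 0 0 0 1)) ::
   ((lin 3 (-5) (-3)), (lin (-5) (-5) 0), nil, (qua 0 0 0 0 1 0)) ::
   ((lin 0 (-1) 0), (lin (-1) (-1) 0), nil, (qua 0 0 0 0 1 0)) ::
   ((lin 0 2 0), (lin 0 0 (-1)), nil, (qua 0 3 0 1 1 0)) ::
   ((cst (-4)), nil, (lin 0 0 3), (lin 0 2 0)) ::
   ((lin 4 3 2), (lin 0 (-1) 0), (qua 2 2 1 1 0 0), (qua 0 0 0 1 0 0)) ::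
   (nil, (cst 1), (lin 2 1 0), (lin 0 0 1)) ::
   ((lin 5 4 3), (lin 0 (-1) 0), nil, (qua 0 2 0 0 0 0)) ::
   ((lin 0 (-1) 0), (lin 1 (-1) 0), nil, nil) ::
   ((cst 1), (cst 1), (lin 1 1 1), nil) ::
   ((lin 2 (-1) 0), (lin 2 1 1), nil, (qua 2 0 0 0 0 1)) ::
   ((lin 4 9 2), (lin 6 3 1), (qua 8 18 11 6 13 2), (qua 0 0 2 0 0 2)) ::
   ((lin 2 2 0), (lin (-3) (-2) (-2)), (qua 2 0 2 0 0 0), nil) ::
   ((cst 2), (cst 2), (lin 0 1 3), nil) ::
   ((cst 1), (cst 1), (lin 0 0 1), nil) ::
   ((cst 1), (cst 3), (lin 0 1 0), (lin 0 1 0)) ::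
   ((cst 1), (cst 3), nil, (lin 3 2 0)) ::
   (nil, (cst 1), (lin 2 2 0), nil) :: nil)%Z.

(* The first eight lead to the family, the others to the systems 1 to 13, in this
   order. *)
Definition remaining : list label :=
  ((0, 0, 5, 6) :: (0, 6, 5, 0) :: (0, 6, 6, 3) :: (1, 6, 4, 3) ::
   (2, 1, 7, 7) :: (2, 5, 7, 3) :: (3, 5, 6, 0) :: (3, 6, 7, 3) ::
   (3, 0, 3, 0) :: (3, 7, 3, 0) :: (3, 0, 3, 3) :: (3, 6, 3, 3) ::
   (3, 7, 3, 3) :: (3, 7, 3, 6) :: (3, 0, 3, 7) :: (3, 6, 3, 7) ::
   (3, 7, 3, 7) :: (0, 1, 0, 4) :: (2, 5, 0, 7) :: (0, 5, 0, 4) ::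
   (0, 1, 6, 3) :: nil)%nat.

Definition label_eqb (l m : label) : bool :=
  let '(a, b, c, d) := l in let '(a', b', c', d') := m in
  ((a =? a') && (b =? b') && (c =? c') && (d =? d'))%nat.

Definition settled (l : label) : bool :=
  if existsb (label_eqb l) remaining then true else refuted certificates l.

(** The effect of [solves_mirror] on labels; the first and third piece change places. *)
Definition mirror_label (l : label) : label :=
  let '(g0, g1, g2, g3) := l in
  (compose 4 g0, compose 6 g3, compose 6 g2, compose 6 g1).

Lemma all_settled :
  forallb (fun g0 => forallb (fun g1 => forallb (fun g2 => forallb (fun g3 =>
    if settled (g0, g1, g2, g3) then true
    else settled (mirror_label (g0, g1, g2, g3)))
  (seq 0 8)) (seq 0 8)) (seq 0 8)) (seq 0 8) = true.
Proof. vm_compute. reflexivity. Qed.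

(** * The surviving labels and the parameters [(x, y)] *)

Lemma listed_of_system k x y : (1 <= k <= 13)%nat -> in_P x y -> y < 1 ->
  system k x y -> listed x y.
Proof.
  intros hk HP hy S. right. exists k. split; [exact hk|].
  destruct (systems_solvable k hk) as (x0 & y0 & E & U).
  destruct (U x y HP S) as [-> ->]; [|exact E].
  intros H; injection H; lra.
Qed.

Lemma listed_in_P x y : listed x y -> in_P x y.
Proof.
  intros [[hx ->]|(k & _ & H)]; [|apply H]. unfold in_P. split; nra.
Qed.

Ltac cancel_factor c := apply (Rmult_eq_reg_l c); [lra | nra].

(** Area vector of Q[x,y], largest entry 1. Here [s = 1 - y], [t = x + y - 1], [u = y - x], so
    [in_P] with [y < 1] says exactly [s, t > 0] and [u >= 0]. *)
Definition standard (x y : R) : quad R := (y, x + y - 1, x, 1).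

Lemma remaining_listed x y g0 g1 g2 g3 : in_P x y -> y < 1 ->
  In (g0, g1, g2, g3) remaining ->
  solves (relabel g0 (standard x y)) (relabel g1 (standard x y))
         (relabel g2 (standard x y)) (relabel g3 (standard x y)) ->
  listed x y.
Proof.
  intros HP hy HI HS. unfold standard in HS.
  assert (hx : 0 < x < 1) by (unfold in_P in HP; lra).
  assert (sys : forall k, (1 <= k <= 13)%nat -> system k x y -> listed x y)
    by (intros k hk; exact (listed_of_system k x y hk HP hy)).
  destruct HP as (h1 & h2 & h3).
  assert (fam : forall m, 0 < m -> m * (y - (x ^ 2 - x + 1)) = 0 -> listed x y).
  { intros m hm E. left. split; [exact hx|]. nra. }
  repeat (destruct HI as [HI|HI];
    [injection HI as <- <- <- <-;
     cbv [solves relabel closing closing_gen margin margin_gen] in HS;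
     destruct HS as (Z1 & Z2 & P1 & P2)|]); [..|destruct HI].
  - apply (fam ((x + y - 1) * y)); nra.
  - apply (fam ((x + y - 1) * y)); nra.
  (* The cofactor [y - x] may vanish, but for [x = y] the second margin is [y ^ 2 - y < 0]. *)
  - destruct (Req_dec x y) as [->|ne].
    + exfalso. nra.
    + apply (fam ((x + y - 1) * (y - x))); nra.
  - apply (fam (x * y)); nra.
  - apply (fam (1 * y)); nra.
  - apply (fam (1 * y)); nra.
  - apply (fam (x * y)); nra.
  - apply (fam ((1 - x) * (x + y))); nra.
  - apply (sys 1%nat); [lia|split; lra].
  - apply (sys 2%nat); [lia|split; lra].
  - apply (sys 3%nat); [lia|split; lra].
  - apply (sys 4%nat); [lia|split; lra].
  - apply (sys 5%nat); [lia|split; lra].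
  - apply (sys 6%nat); [lia|split; lra].
  - apply (sys 7%nat); [lia|split; [cancel_factor y|cancel_factor x]].
  - apply (sys 8%nat); [lia|split; [cancel_factor x|cancel_factor y]].
  - apply (sys 9%nat); [lia|split; [cancel_factor x|cancel_factor (y * (2 - x - y))]].
  - apply (sys 10%nat); [lia|split; [cancel_factor (x + y - 1)|cancel_factor 1]].
  - apply (sys 11%nat); [lia|split; lra].
  - apply (sys 12%nat); [lia|split; [cancel_factor (x + y - 1)|cancel_factor 1]].
  - apply (sys 13%nat); [lia|split; lra].
Qed.

Lemma label_eqb_eq l m : label_eqb l m = true -> l = m.
Proof.
  destruct l as [[[a b] c] d], m as [[[a' b'] c'] d']; simpl.
  intros H. repeat apply andb_prop in H as [H ?].
  repeat match goal with T : (_ =? _)%nat = true |- _ =>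
    apply Nat.eqb_eq in T end. congruence.
Qed.

Lemma settled_listed x y g0 g1 g2 g3 : in_P x y -> y < 1 ->
  settled (g0, g1, g2, g3) = true ->
  solves (relabel g0 (standard x y)) (relabel g1 (standard x y))
         (relabel g2 (standard x y)) (relabel g3 (standard x y)) ->
  listed x y.
Proof.
  intros HP hy H HS. unfold settled in H.
  destruct (existsb _ _) eqn:E in H.
  - apply existsb_exists in E as (l & HI & El). apply label_eqb_eq in El as <-.
    eauto using remaining_listed.
  - destruct HP as (h1 & h2 & h3). exfalso.
    apply (refuted_sound (1 - y) (x + y - 1) (y - x)) in H; try lra.
    apply H. unfold standard in HS.
    replace (1 - y + (x + y - 1) + (y - x)) with y by ring.
    replace (1 - y + (x + y - 1)) with x by ring.
    replace (2 * (1 - y) + (x + y - 1) + (y - x)) with 1 by ring.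
    exact HS.
Qed.

Lemma solves_listed x y g0 g1 g2 g3 : in_P x y -> y < 1 ->
  (g0 < 8)%nat -> (g1 < 8)%nat -> (g2 < 8)%nat -> (g3 < 8)%nat ->
  solves (relabel g0 (standard x y)) (relabel g1 (standard x y))
         (relabel g2 (standard x y)) (relabel g3 (standard x y)) ->
  listed x y.
Proof.
  intros HP hy h0 h1 h2 h3 HS.
  pose proof all_settled as H.
  rewrite forallb_forall in H. specialize (H g0 ltac:(apply in_seq; lia)).
  rewrite forallb_forall in H. specialize (H g1 ltac:(apply in_seq; lia)).
  rewrite forallb_forall in H. specialize (H g2 ltac:(apply in_seq; lia)).
  rewrite forallb_forall in H. specialize (H g3 ltac:(apply in_seq; lia)).
  destruct (settled (g0, g1, g2, g3)) eqn:E.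
  - eauto using settled_listed.
  - apply solves_mirror in HS. rewrite !relabel_compose in HS by lia.
    exact (settled_listed x y _ _ _ _ HP hy H HS).
Qed.

Lemma standard_vertices x y :
  standard x y = quad_value (1 - y) (x + y - 1) (y - x) vertices.
Proof.
  unfold standard; simpl. f_equal; [f_equal; [f_equal|]|]; ring.
Qed.

(** Many margins needed for the converse have nonnegative coefficients in [s], [t], [u], which
    computation can check; the others are derived from the equations and the numerical values. *)
Lemma margin_pos x y g0 g2 g3 : in_P x y -> y < 1 ->
  (let I := margin_gen psub pmul (relabel g0 vertices) (relabel g2 vertices)
              (relabel g3 vertices) in
   coefficients_nonneg I && some_positive_without_u I)%bool = true ->
  0 < margin (relabel g0 (standard x y)) (relabel g2 (standard x y))
             (relabel g3 (standard x y)).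
Proof.
  intros (h1 & h2 & h3) hy H. apply andb_prop in H as [H G].
  rewrite standard_vertices, <- !quad_value_relabel, <- pvalue_margin.
  apply pvalue_pos; trivial; lra.
Qed.

Lemma value_lt_1 k x y : value k x y -> y < 1.
Proof.
  pose proof (sqrt_sqrt 2 ltac:(lra)). pose proof (sqrt_pos 2).
  pose proof (sqrt_sqrt 17 ltac:(lra)). pose proof (sqrt_pos 17).
  do 14 (destruct k as [|k]; [cbv [value trunc5]; intros V; first [lra | nra]|]).
  intros [].
Qed.

Ltac use_label g0 g1 g2 g3 :=
  exists g0, g1, g2, g3; repeat (split; [lia|]);
  split; [|split; [|split]];
  [ | | first [apply margin_pos; [assumption|assumption|reflexivity] | idtac]
    | first [ rewrite !relabel_compose by lia;
              apply margin_pos; [assumption|assumption|reflexivity] | idtac] ];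
  cbv [relabel closing closing_gen margin margin_gen standard].

(** One label per case is enough: the first of [remaining] for the family, and for a system the
    label that led to it. Multiplying [S1] and [S2] restores the factors that were cancelled from
    the closing equations. *)
Lemma listed_solves x y : listed x y ->
  in_P x y /\ y < 1 /\
  exists g0 g1 g2 g3, (g0 < 8)%nat /\ (g1 < 8)%nat /\ (g2 < 8)%nat /\ (g3 < 8)%nat /\
  solves (relabel g0 (standard x y)) (relabel g1 (standard x y))
         (relabel g2 (standard x y)) (relabel g3 (standard x y)).
Proof.
  intros HL. pose proof (listed_in_P x y HL) as HP.
  split; [exact HP|].
  destruct HL as [[hx Ey]|(k & hk & _ & S & V)].
  - assert (hy : y < 1) by (rewrite Ey; nra).
    split; [exact hy|]. use_label 0%nat 0%nat 5%nat 6%nat.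
    + rewrite Ey; ring.
    + rewrite Ey; ring.
  - pose proof (value_lt_1 k x y V) as hy.
    split; [exact hy|].
    assert (K : (k = 1 \/ k = 2 \/ k = 3 \/ k = 4 \/ k = 5 \/ k = 6 \/ k = 7 \/
                 k = 8 \/ k = 9 \/ k = 10 \/ k = 11 \/ k = 12 \/ k = 13)%nat)
      by lia.
    repeat (destruct K as [->|K]); [..|rewrite K in *].
    all: cbv [system] in S; destruct S as [S1 S2]; cbv [value trunc5] in V.
    + use_label 3%nat 0%nat 3%nat 0%nat; first [lra|nra].
    + use_label 3%nat 7%nat 3%nat 0%nat; first [lra|nra].
    + use_label 3%nat 0%nat 3%nat 3%nat; first [lra|nra].
    + use_label 3%nat 6%nat 3%nat 3%nat; first [lra|nra].
    + pose proof (sqrt_sqrt 2 ltac:(lra)). pose proof (sqrt_pos 2).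
      assert (1.4142 < sqrt 2 < 1.4143) by (split; nra).
      assert (0.4775 < x < 0.4777) by lra. assert (0.8152 < y < 0.8154) by lra.
      use_label 3%nat 7%nat 3%nat 3%nat; first [lra|nra].
    + use_label 3%nat 7%nat 3%nat 6%nat; first [lra|nra].
    + apply (f_equal (Rmult y)) in S1. apply (f_equal (Rmult x)) in S2.
      use_label 3%nat 0%nat 3%nat 7%nat; first [lra|nra].
    + apply (f_equal (Rmult x)) in S1. apply (f_equal (Rmult y)) in S2.
      use_label 3%nat 6%nat 3%nat 7%nat; first [lra|nra].
    + apply (f_equal (Rmult x)) in S1. apply (f_equal (Rmult (y * (2 - x - y)))) in S2.
      use_label 3%nat 7%nat 3%nat 7%nat; first [lra|nra].
    + apply (f_equal (Rmult (x + y - 1))) in S1.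
      use_label 0%nat 1%nat 0%nat 4%nat; first [lra|nra].
    + use_label 2%nat 5%nat 0%nat 7%nat; first [lra|nra].
    + apply (f_equal (Rmult (x + y - 1))) in S1.
      use_label 0%nat 5%nat 0%nat 4%nat; first [lra|nra].
    + use_label 0%nat 1%nat 6%nat 3%nat; first [lra|nra].
Qed.

(** * Convex quadrangles *)

Ltac coords :=
  repeat match goal with x : (R * R)%type |- _ => destruct x end;
  unfold turn, cross, vec, between in *; cbn [fst snd] in *.

Lemma turn_cycle a b c : turn b c a = turn a b c.
Proof. coords; ring. Qed.

Lemma same_region_sym A B : same_region A B -> same_region B A.
Proof. firstorder. Qed.

Lemma same_region_trans A B C :
  same_region A B -> same_region B C -> same_region A C.
Proof. firstorder. Qed.

(** The entry at a corner is twice the signed area of the triangle of the other three corners. *)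
Definition areas (w : quad point) : quad R :=
  let '(a, b, c, d) := w in (turn b c d, turn c d a, turn d a b, turn a b c).

Definition hull (w : quad point) : region :=
  let '(a, b, c, d) := w in hull4 a b c d.

Definition all_positive (w : quad R) : Prop :=
  let '(a, b, c, d) := w in 0 < a /\ 0 < b /\ 0 < c /\ 0 < d.

Definition orientation (i : nat) : R := if (i <? 4)%nat then 1 else -1.

Lemma areas_relabel i w :
  areas (relabel i w) = scale (orientation i) (relabel i (areas w)).
Proof.
  destruct w as [[[a b] c] d].
  assert (E : forall p q r s p' q' r' s' : R, p = p' -> q = q' -> r = r' -> s = s' ->
    (p, q, r, s) = (p', q', r', s')) by (intros; subst; reflexivity).
  do 8 (destruct i as [|i];
    [cbn [areas relabel scale orientation Nat.ltb Nat.leb]; apply E; coords; ring|]).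
  cbn [areas relabel scale orientation Nat.ltb Nat.leb]; apply E; coords; ring.
Qed.

(** Either diagonal cuts the quadrangle into two triangles of the same total area. Three entries of
    an area vector thus determine the fourth. *)
Lemma areas_sum a b c d :
  turn b c d + turn d a b = turn c d a + turn a b c.
Proof. coords; ring. Qed.

Lemma hull4_rotate a b c d z : hull4 a b c d z -> hull4 b c d a z.
Proof.
  intros (s & t & u & v & ? & ? & ? & ? & ? & ->).
  exists t, u, v, s. repeat (split; [lra|]). f_equal; ring.
Qed.

Lemma hull4_reverse a b c d z : hull4 a b c d z -> hull4 d c b a z.
Proof.
  intros (s & t & u & v & ? & ? & ? & ? & ? & ->).
  exists v, u, t, s. repeat (split; [lra|]). f_equal; ring.
Qed.

Lemma hull_relabel i w : same_region (hull (relabel i w)) (hull w).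
Proof.
  destruct w as [[[a b] c] d]. intros z.
  do 8 (destruct i as [|i]; [cbn [relabel hull];
    split; eauto 6 using hull4_rotate, hull4_reverse|]).
  cbn [relabel hull]; split; eauto 6 using hull4_rotate, hull4_reverse.
Qed.

Lemma hull4_vertices a b c d :
  hull4 a b c d a /\ hull4 a b c d b /\ hull4 a b c d c /\ hull4 a b c d d.
Proof.
  assert (H : forall a b c d, hull4 a b c d a).
  { clear. intros. exists 1, 0, 0, 0. repeat (split; [lra|]).
    destruct a; cbn [fst snd]; f_equal; ring. }
  repeat split; auto using hull4_rotate.
Qed.

Lemma hull4_halfplane w x y z a b e :
  0 <= turn a b w -> 0 <= turn a b x -> 0 <= turn a b y -> 0 <= turn a b z ->
  hull4 w x y z e -> 0 <= turn a b e.
Proof.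
  intros hw hx hy hz (s & t & u & v & hs & ht & hu & hv & S & ->).
  match goal with |- 0 <= ?T =>
    replace T with (s * turn a b w + t * turn a b x + u * turn a b y
                    + v * turn a b z) end.
  - pose proof (Rmult_le_pos _ _ hs hw). pose proof (Rmult_le_pos _ _ ht hx).
    pose proof (Rmult_le_pos _ _ hu hy). pose proof (Rmult_le_pos _ _ hv hz). lra.
  - replace s with (1 - t - u - v) by lra. coords; ring.
Qed.

Lemma in_triangle a b c z : 0 < turn a b c ->
  0 <= turn a b z -> 0 <= turn b c z -> 0 <= turn c a z ->
  exists s t u, 0 <= s /\ 0 <= t /\ 0 <= u /\ s + t + u = 1 /\
    z = (s * fst a + t * fst b + u * fst c, s * snd a + t * snd b + u * snd c).
Proof.
  intros T h1 h2 h3.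
  exists (turn b c z / turn a b c), (turn c a z / turn a b c),
    (turn a b z / turn a b c).
  assert (D : forall x, 0 <= x -> 0 <= x / turn a b c).
  { intros x hx. apply Rmult_le_pos; [exact hx|].
    apply Rlt_le, Rinv_0_lt_compat, T. }
  do 3 (split; [apply D; assumption|]). clear D h1 h2 h3. split.
  - coords. field. lra.
  - coords. f_equal; field; lra.
Qed.

Lemma hull4_halfplanes a b c d z : all_positive (areas (a, b, c, d)) ->
  hull4 a b c d z <->
  0 <= turn a b z /\ 0 <= turn b c z /\ 0 <= turn c d z /\ 0 <= turn d a z.
Proof.
  intros (h1 & h2 & h3 & h4).
  assert (Z : forall x y : point, turn x y x = 0 /\ turn x y y = 0).
  { intros x y; coords; split; ring. }
  split.
  - intros H.
    repeat split; refine (hull4_halfplane _ _ _ _ _ _ _ _ _ _ _ H);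
      rewrite ?(proj1 (Z _ _)), ?(proj2 (Z _ _));
      first [lra | rewrite turn_cycle; lra | rewrite <- turn_cycle; lra].
  - intros (k1 & k2 & k3 & k4).
    (* The diagonal through [a] and [c] decides which of two triangles contains [z]. *)
    destruct (Rle_or_lt 0 (turn c a z)) as [L|L].
    + destruct (in_triangle a b c z h4 k1 k2 L) as (s & t & u & ? & ? & ? & ? & ->).
      exists s, t, u, 0. repeat (split; [lra|]). f_equal; ring.
    + destruct (in_triangle c d a z) as (s & t & u & ? & ? & ? & ? & ->);
        try lra. { rewrite turn_cycle in *. revert L. coords; lra. }
      exists u, 0, s, t. repeat (split; [lra|]). f_equal; ring.
Qed.

(** A corner is an extreme point: the functional [l], the sum of the areas over the two sides at
    [a], is nonnegative on the quadrangle and vanishes only at [a]. In a convex combination equal to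
    [a], every point of positive weight is therefore [a]. *)
Lemma vertex_among a b c d w x y z : all_positive (areas (a, b, c, d)) ->
  hull4 a b c d w -> hull4 a b c d x -> hull4 a b c d y -> hull4 a b c d z ->
  hull4 w x y z a -> a = w \/ a = x \/ a = y \/ a = z.
Proof.
  intros P hw hx hy hz (s & t & u & v & hs & ht & hu & hv & S & E).
  pose proof (proj1 (proj2 (proj2 P))) as T. cbn [areas] in T.
  apply (hull4_halfplanes _ _ _ _ _ P) in hw, hx, hy, hz.
  set (l e := turn d a e + turn a b e).
  assert (L : forall e, l e = 0 -> 0 <= turn d a e -> 0 <= turn a b e -> a = e).
  { intros e H0 H1 H2. unfold l in H0.
    assert (E1 : turn d a e = 0) by lra. assert (E2 : turn a b e = 0) by lra.
    assert (F : fst e - fst a = (turn d a e * (fst b - fst a)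
                 + turn a b e * (fst d - fst a)) / turn d a b).
    { clear - T. coords. field. lra. }
    assert (G : snd e - snd a = (turn d a e * (snd b - snd a)
                 + turn a b e * (snd d - snd a)) / turn d a b).
    { clear - T. coords. field. lra. }
    rewrite E1, E2 in F, G. unfold Rdiv in F, G.
    rewrite !Rmult_0_l, Rplus_0_r, Rmult_0_l in F, G.
    destruct a, e; cbn [fst snd] in *. f_equal; lra. }
  assert (Z : s * l w + t * l x + u * l y + v * l z = 0).
  { transitivity (l a); [|unfold l; clear; coords; ring].
    rewrite E at 1. unfold l. replace s with (1 - t - u - v) by lra.
    clear. coords. ring. }
  assert (0 <= l w) by (unfold l; lra). assert (0 <= l x) by (unfold l; lra).
  assert (0 <= l y) by (unfold l; lra). assert (0 <= l z) by (unfold l; lra).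
  assert (0 <= s * l w) by nra. assert (0 <= t * l x) by nra.
  assert (0 <= u * l y) by nra. assert (0 <= v * l z) by nra.
  destruct (Rlt_or_le 0 s) as [hs'|hs'];
    [left; apply L; [|tauto|tauto]; assert (s * l w = 0) by lra; nra|].
  destruct (Rlt_or_le 0 t) as [ht'|ht'];
    [right; left; apply L; [|tauto|tauto]; assert (t * l x = 0) by lra; nra|].
  destruct (Rlt_or_le 0 u) as [hu'|hu'];
    [right; right; left; apply L; [|tauto|tauto]; assert (u * l y = 0) by lra; nra|].
  right; right; right; apply L; [|tauto|tauto]. assert (v * l z = 0) by lra.
  assert (0 < v) by lra. nra.
Qed.

(* Three of the four turns already fix the cyclic order of the corners. *)
Lemma match_cycle a b c d w x y z : all_positive (areas (a, b, c, d)) ->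
  (forall e, hull4 a b c d e -> hull4 w x y z e) ->
  hull4 a b c d w -> hull4 a b c d x -> hull4 a b c d y -> hull4 a b c d z ->
  0 < turn w x y -> 0 < turn z w x -> 0 < turn x y z ->
  exists i, (i < 4)%nat /\ (w, x, y, z) = relabel i (a, b, c, d).
Proof.
  intros P H vw vx vy vz h1 h2 h3.
  destruct (hull4_vertices a b c d) as (va & vb & vc & vd).
  apply H in va, vb, vc, vd.
  assert (Ha : a = w \/ a = x \/ a = y \/ a = z)
    by (eapply vertex_among; eassumption).
  assert (rot : forall i : nat, (i < 4)%nat ->
     all_positive (areas (relabel i (a, b, c, d)))).
  { intros i hi. rewrite areas_relabel. revert P.
    do 4 (destruct i as [|i]; [cbn; intros; repeat split; lra|]). lia. }
  assert (Hb : b = w \/ b = x \/ b = y \/ b = z).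
  { apply (vertex_among b c d a w x y z (rot 1%nat ltac:(lia)));
      auto using hull4_rotate. }
  assert (Hc : c = w \/ c = x \/ c = y \/ c = z).
  { apply (vertex_among c d a b w x y z (rot 2%nat ltac:(lia)));
      auto using hull4_rotate. }
  assert (Hd : d = w \/ d = x \/ d = y \/ d = z).
  { apply (vertex_among d a b c w x y z (rot 3%nat ltac:(lia)));
      auto 6 using hull4_rotate. }
  clear rot vw vx vy vz va vb vc vd H.
  assert (N1 : forall p q, turn p p q = 0) by (intros; coords; ring).
  assert (N2 : forall p q, turn p q q = 0) by (intros; coords; ring).
  assert (N3 : forall p q, turn p q p = 0) by (intros; coords; ring).
  destruct P as (P1 & P2 & P3 & P4).
  (* A repeated corner makes one of the turns [P1] to [P4] vanish; a permutation that is not a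
     rotation contradicts the signs of [h1], [h2], [h3]. *)
  destruct Ha as [->|[->|[->| ->]]]; destruct Hb as [->|[->|[->| ->]]];
    rewrite ?N1, ?N2, ?N3 in P1, P2, P3, P4; try lra;
    destruct Hc as [->|[->|[->| ->]]];
    rewrite ?N1, ?N2, ?N3 in P1, P2, P3, P4; try lra;
    destruct Hd as [->|[->|[->| ->]]];
    rewrite ?N1, ?N2, ?N3 in P1, P2, P3, P4; try lra;
    first [ exists 0%nat; split; [lia|reflexivity]
          | exists 1%nat; split; [lia|reflexivity]
          | exists 2%nat; split; [lia|reflexivity]
          | exists 3%nat; split; [lia|reflexivity]
          | exfalso; coords; lra ].
Qed.

(** * Affine maps *)

Definition map_quad {S T} (f : S -> T) (w : quad S) : quad T :=
  let '(a, b, c, d) := w in (f a, f b, f c, f d).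

Lemma areas_affine f : affine_map f ->
  exists k, k <> 0 /\ forall w, areas (map_quad f w) = scale k (areas w).
Proof.
  intros (m11 & m12 & m21 & m22 & b1 & b2 & hk & Hf).
  exists (m11 * m22 - m12 * m21). split; [exact hk|].
  assert (T : forall a b c, turn (f a) (f b) (f c) =
                            (m11 * m22 - m12 * m21) * turn a b c).
  { intros a b c. rewrite !Hf. clear. coords; ring. }
  intros [[[a b] c] d]. cbn [map_quad areas scale]. rewrite !T. reflexivity.
Qed.

Lemma hull_affine f w : affine_map f ->
  same_region (image f (hull w)) (hull (map_quad f w)).
Proof.
  intros (m11 & m12 & m21 & m22 & b1 & b2 & hk & Hf). destruct w as [[[a b] c] d].
  cbn [hull map_quad].
  assert (E : forall s t u v, s + t + u + v = 1 ->
    f (s * fst a + t * fst b + u * fst c + v * fst d,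
       s * snd a + t * snd b + u * snd c + v * snd d) =
    (s * fst (f a) + t * fst (f b) + u * fst (f c) + v * fst (f d),
     s * snd (f a) + t * snd (f b) + u * snd (f c) + v * snd (f d))).
  { intros s t u v S. rewrite !Hf. cbn [fst snd].
    replace s with (1 - t - u - v) by lra. f_equal; ring. }
  intros z; split.
  - intros (y & (s & t & u & v & hs & ht & hu & hv & S & ->) & ->).
    exists s, t, u, v. repeat (split; [assumption|]). apply E, S.
  - intros (s & t & u & v & hs & ht & hu & hv & S & ->).
    eexists. split; [|symmetry; apply E, S].
    exists s, t, u, v. repeat (split; [assumption|]). reflexivity.
Qed.

(** The map is fixed by three corners and has determinant [k]. The areas that [d] forms with pairs
    of them are, divided by [D], its barycentric coordinates; proportional vectors hence force [d]
    to go to [d']. *)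
Lemma affine_map_of_areas w w' k : k <> 0 -> all_positive (areas w) ->
  areas w' = scale k (areas w) -> exists f, affine_map f /\ map_quad f w = w'.
Proof.
  destruct w as [[[a b] c] d], w' as [[[a' b'] c'] d'].
  cbn [areas scale map_quad all_positive]. intros hk (_ & _ & _ & T) E.
  injection E as E1 E2 E3 E4.
  set (m (g : point -> R) (h : point -> R) :=
    (h b - h a) * (g c' - g b') + (h c - h b) * (g a' - g b')).
  set (D := turn a b c) in *.
  set (m11 := - m fst snd / D). set (m12 := m fst fst / D).
  set (m21 := - m snd snd / D). set (m22 := m snd fst / D).
  exists (fun z => (m11 * fst z + m12 * snd z + (fst b' - m11 * fst b - m12 * snd b),
                    m21 * fst z + m22 * snd z + (snd b' - m21 * fst b - m22 * snd b))).
  assert (F : forall z,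
    (m11 * fst z + m12 * snd z + (fst b' - m11 * fst b - m12 * snd b),
     m21 * fst z + m22 * snd z + (snd b' - m21 * fst b - m22 * snd b)) =
    (fst b' + (turn z a b * (fst c' - fst b') + turn b c z * (fst a' - fst b')) / D,
     snd b' + (turn z a b * (snd c' - snd b') + turn b c z * (snd a' - snd b')) / D)).
  { intros z. unfold m11, m12, m21, m22, m.
    assert (D <> 0) by lra. clearbody D. clear - H.
    coords. f_equal; field; assumption. }
  split.
  - exists m11, m12, m21, m22,
      (fst b' - m11 * fst b - m12 * snd b), (snd b' - m21 * fst b - m22 * snd b).
    split; [|reflexivity].
    replace (m11 * m22 - m12 * m21) with (turn a' b' c' / D).
    + rewrite E4. unfold Rdiv. rewrite Rmult_assoc, Rinv_r; lra.
    + unfold m11, m12, m21, m22, m, D in *. clear - T.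
      coords. field. lra.
  - assert (Z : turn a a b = 0 /\ turn b c b = 0 /\ turn b a b = 0 /\ turn b c c = 0
                /\ turn c a b = D /\ turn b c a = D).
    { unfold D. clear. coords; repeat split; ring. }
    destruct Z as (Z1 & Z2 & Z3 & Z4 & Z5 & Z6).
    rewrite !F, Z1, Z2, Z3, Z4, Z5, Z6.
    assert (G : forall p q, q = D * p -> q / D = p).
    { intros p q ->. field. lra. }
    rewrite (surjective_pairing a'), (surjective_pairing b'),
      (surjective_pairing c'), (surjective_pairing d'). cbn [fst snd].
    assert (X : forall g : point -> R, (g = fst \/ g = snd) ->
      turn d a b * (g c' - g b') + turn b c d * (g a' - g b') = D * (g d' - g b')).
    { intros g Hg. apply (Rmult_eq_reg_l k); [|exact hk].
      transitivity (turn d' a' b' * (g c' - g b') + turn b' c' d' * (g a' - g b'));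
        [rewrite E1, E3; ring|].
      transitivity (turn a' b' c' * (g d' - g b')); [|rewrite E4; ring].
      clear - Hg. destruct Hg as [-> | ->]; coords; ring. }
    repeat f_equal; try (rewrite G with (1 := X _ (or_introl eq_refl)); ring);
      try (rewrite G with (1 := X _ (or_intror eq_refl)); ring);
      field; lra.
Qed.

Lemma affine_image_of_areas Q w w' i k : same_region Q (hull w) ->
  all_positive (areas w) -> 0 < k -> (i < 8)%nat ->
  areas w' = scale k (relabel i (areas w)) -> affine_image Q (hull w').
Proof.
  intros HQ P hk hi E.
  destruct (relabel_inverse i hi) as (j & hj & J).
  assert (O : orientation j = 1 \/ orientation j = -1)
    by (unfold orientation; destruct (j <? 4)%nat; auto).
  destruct (affine_map_of_areas w (relabel j w') (orientation j * k)) as (f & Hf & M).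
  - destruct O as [-> | ->]; lra.
  - exact P.
  - rewrite areas_relabel, E, relabel_scale, (proj1 (J _ _)).
    destruct (areas w) as [[[? ?] ?] ?]; cbn [scale].
    rewrite !Rmult_assoc; reflexivity.
  - exists f. split; [exact Hf|].
    apply same_region_trans with (hull (relabel j w')).
    + apply same_region_sym, hull_relabel.
    + rewrite <- M. intros z. rewrite <- (hull_affine f w Hf z).
      unfold image. split; intros (y & Hy & ->); exists y; split; auto; apply HQ; auto.
Qed.

(** * Sectors *)

Lemma sector_reverse p a b c : same_region (sector p a b c) (sector p c b a).
Proof.
  assert (S : forall a b z, segment a b z -> segment b a z).
  { clear. intros a b z (t & ht & ->). exists (1 - t). split; [lra|].
    unfold between. f_equal; ring. }
  intros z; split; intros (w & [H|H] & K); exists w; split; auto.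
Qed.

Lemma sector_corners p a b c :
  sector p a b c a /\ sector p a b c b /\ sector p a b c c /\ sector p a b c p.
Proof.
  assert (E : forall a b, segment a b a /\ segment a b b).
  { clear. intros a b. split; [exists 0|exists 1]; (split; [lra|]);
      destruct a, b; unfold between; cbn [fst snd]; f_equal; ring. }
  pose proof (E a b). pose proof (E b c). pose proof (E p a).
  pose proof (E p b). pose proof (E p c).
  repeat split; [exists a|exists b|exists c|exists a]; tauto.
Qed.

Lemma sector_sub_hull p a b c z : sector p a b c z -> hull4 a b c p z.
Proof.
  intros (w & [(t & ht & ->)|(t & ht & ->)] & (r & hr & ->)).
  - exists (r * (1 - t)), (r * t), 0, (1 - r).
    do 4 (split; [nra|]). split; [ring|]. unfold between; cbn [fst snd].
    f_equal; ring.
  - exists 0, (r * (1 - t)), (r * t), (1 - r).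
    do 4 (split; [nra|]). split; [ring|]. unfold between; cbn [fst snd].
    f_equal; ring.
Qed.

(** The line from [p] to [b] splits the quadrangle into two triangles with apex [p], and a ray from
    [p] meets the opposite side of its triangle. *)
Lemma sector_hull p a b c : all_positive (areas (a, b, c, p)) ->
  same_region (sector p a b c) (hull4 a b c p).
Proof.
  intros P z. split; [apply sector_sub_hull|].
  intros H. apply (hull4_halfplanes _ _ _ _ _ P) in H as (k1 & k2 & k3 & k4).
  destruct P as (P1 & P2 & P3 & P4).
  cbn [areas] in P1, P2, P3, P4.
  assert (G : forall q r, 0 < turn p q r -> 0 <= turn p q z -> 0 <= turn q r z ->
    0 <= turn r p z -> exists w, segment q r w /\ segment p w z).
  { clear. intros q r T h1 h2 h3.
    destruct (in_triangle p q r z T h1 h2 h3) as (s & t & u & hs & ht & hu & S & ->).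
    (* For [s = 1] the point is [p] itself and determines no ray; any point of the side will do. *)
    destruct (Req_dec s 1) as [->|ne].
    - exists q. split; [exists 0|exists 0]; (split; [lra|]);
        unfold between; cbn [fst snd].
      + destruct q; cbn [fst snd]; f_equal; ring.
      + replace t with 0 by lra. replace u with 0 by lra. f_equal; ring.
    - exists (between (u / (1 - s)) q r). split.
      + exists (u / (1 - s)). split; [|reflexivity].
        split; [apply Rmult_le_pos; [lra|apply Rlt_le, Rinv_0_lt_compat; lra]|].
        apply (Rmult_le_reg_r (1 - s)); [lra|]. unfold Rdiv.
        rewrite Rmult_assoc, Rinv_l by lra. lra.
      + exists (1 - s). split; [lra|]. unfold between; cbn [fst snd].
        replace t with (1 - s - u) by lra. f_equal; field; lra. }
  destruct (Rle_or_lt 0 (turn b p z)) as [L|L].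
  - destruct (G a b) as (w & Hw & Hz); try assumption. exists w; auto.
  - destruct (G b c) as (w & Hw & Hz); try assumption.
    + rewrite <- turn_cycle; assumption.
    + clear - L. coords; lra.
    + exists w; auto.
Qed.

(** * Interiors *)

(** A short step from [z], perpendicular to the line and away from the half-plane, stays in [A] but
    lowers [turn a b] by [h] times the squared length of [a]-[b]. The choice of [n] keeps the step
    inside the neighbourhood. *)
Lemma interior_halfplane A a b z : (forall y, A y -> 0 <= turn a b y) -> a <> b ->
  interior2 A z -> 0 < turn a b z.
Proof.
  intros H ne [e He].
  set (n := Rabs (fst b - fst a) + Rabs (snd b - snd a) + 1).
  pose proof (Rabs_pos (fst b - fst a)). pose proof (Rabs_pos (snd b - snd a)).
  pose proof (cond_pos e) as ep.
  set (h := e / n).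
  assert (hn : h * n = e) by (unfold h, n; field; unfold n in *; lra).
  assert (hp : 0 < h) by (apply Rdiv_lt_0_compat; unfold n; lra).
  assert (B : A (fst z + h * (snd b - snd a), snd z - h * (fst b - fst a))).
  { apply He. split; cbn [fst snd]; unfold ball; cbn;
      unfold AbsRing_ball, abs, minus, plus, opp; cbn.
    - replace (fst z + h * (snd b - snd a) + - fst z)
        with (h * (snd b - snd a)) by ring.
      rewrite Rabs_mult, (Rabs_pos_eq h) by lra. unfold n in hn. nra.
    - replace (snd z - h * (fst b - fst a) + - snd z)
        with (- (h * (fst b - fst a))) by ring.
      rewrite Rabs_Ropp, Rabs_mult, (Rabs_pos_eq h) by lra. unfold n in hn. nra. }
  apply H in B.
  assert (0 < (fst b - fst a) * (fst b - fst a) + (snd b - snd a) * (snd b - snd a)).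
  { destruct a as [a1 a2], b as [b1 b2]; cbn [fst snd].
    assert (S : forall x y : R, x <> y -> 0 < (y - x) * (y - x))
      by (intros x y hxy; apply (Rsqr_pos_lt (y - x)); lra).
    destruct (Req_dec a1 b1) as [->|h1]; 
      [|pose proof (S _ _ h1); pose proof (Rle_0_sqr (b2 - a2)); unfold Rsqr in *; lra].
    destruct (Req_dec a2 b2) as [->|h2]; [|pose proof (S _ _ h2); lra].
    now contradiction ne. }
  clear - H2 B hp. revert B. coords. nra.
Qed.

Lemma halfplane_interior a b z : 0 < turn a b z ->
  locally z (fun y => 0 < turn a b y).
Proof.
  destruct z as [z1 z2]. intros T.
  set (n := Rabs (fst b - fst a) + Rabs (snd b - snd a) + 1).
  pose proof (Rabs_pos (fst b - fst a)). pose proof (Rabs_pos (snd b - snd a)).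
  assert (hp : 0 < turn a b (z1, z2) / n) by (apply Rdiv_lt_0_compat; unfold n; lra).
  assert (F : forall y : point, turn a b y = turn a b (z1, z2)
      + (fst b - fst a) * (snd y + - z2) - (snd b - snd a) * (fst y + - z1))
    by (clear; intros y; coords; ring).
  exists (mkposreal _ hp). intros [y1 y2] [h1 h2]. rewrite F. cbn [pos fst snd] in *.
  unfold ball in h1, h2; cbn in h1, h2.
  unfold AbsRing_ball, abs, minus, plus, opp in h1, h2; cbn in h1, h2.
  assert (E : turn a b (z1, z2) / n * n = turn a b (z1, z2)) by (field; unfold n; lra).
  set (k := turn a b (z1, z2) / n) in *. clearbody k.
  pose proof (Rle_abs (- ((fst b - fst a) * (y2 + - z2)))) as I1.
  pose proof (Rle_abs ((snd b - snd a) * (y1 + - z1))) as I2.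
  rewrite Rabs_Ropp, Rabs_mult in I1. rewrite Rabs_mult in I2.
  assert (J1 := Rmult_le_compat_l _ _ _ H (Rlt_le _ _ h2)).
  assert (J2 := Rmult_le_compat_l _ _ _ H0 (Rlt_le _ _ h1)).
  unfold n in E. lra.
Qed.

(** * From a dissection to labels *)

Lemma scale_scale k l w : scale k (scale l w) = scale (k * l) w.
Proof. destruct w as [[[? ?] ?] ?]; cbn [scale]. rewrite !Rmult_assoc; reflexivity. Qed.

Lemma all_positive_relabel i w : all_positive w -> all_positive (relabel i w).
Proof.
  destruct w as [[[? ?] ?] ?]; cbn [all_positive]; intros H.
  do 8 (destruct i as [|i]; [cbn; tauto|]). cbn; tauto.
Qed.

Lemma all_positive_scale k w : 0 < k -> all_positive w -> all_positive (scale k w).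
Proof.
  destruct w as [[[? ?] ?] ?]; cbn [all_positive scale].
  intros; repeat split; apply Rmult_lt_0_compat; tauto.
Qed.

(** Here [z] is the interior point of the dissection, so no sign is assumed for the turn there. The
    relabelling [j] makes the image positively oriented, and [match_cycle] then identifies its
    corners with those of the sector. *)
Lemma areas_of_affine_sector Q P v b c d w x y z :
  same_region Q (hull4 v b c d) -> all_positive (areas (v, b, c, d)) ->
  affine_image Q P -> same_region P (sector z w x y) ->
  0 < turn w x y -> 0 < turn z w x -> 0 < turn x y z ->
  exists k i, 0 < k /\ (i < 8)%nat /\
    areas (w, x, y, z) = scale k (relabel i (areas (v, b, c, d))).
Proof.
  intros HQ HA (f & Hf & HP) HS h1 h2 h3.
  destruct (areas_affine f Hf) as (k & nk & Hk).
  set (V := (v, b, c, d)) in *.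
  assert (HP' : same_region (hull (map_quad f V)) (sector z w x y)).
  { apply same_region_trans with P; [|exact HS].
    apply same_region_sym, same_region_trans with (1 := HP).
    intros e. rewrite <- (hull_affine f V Hf e).
    unfold image. split; intros (g & Hg & ->); exists g; split; auto; apply HQ; auto. }
  assert (M : forall j, (j < 8)%nat -> 0 < orientation j * k ->
    exists i, (i < 4)%nat /\ (w, x, y, z) = relabel i (relabel j (map_quad f V))).
  { intros j hj hk.
    assert (HP2 : same_region (hull (relabel j (map_quad f V))) (sector z w x y)).
    { exact (same_region_trans _ _ _ (hull_relabel j _) HP'). }
    assert (PA : all_positive (areas (relabel j (map_quad f V)))).
    { rewrite areas_relabel, Hk, relabel_scale, scale_scale.
      apply all_positive_scale; [exact hk|]. apply all_positive_relabel, HA. }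
    destruct (relabel j (map_quad f V)) as [[[a' b'] c'] d']. cbn [hull] in HP2.
    destruct (sector_corners z w x y) as (s1 & s2 & s3 & s4).
    apply HP2 in s1, s2, s3, s4.
    apply match_cycle; trivial.
    intros e He. apply sector_sub_hull, HP2, He. }
  assert (J : exists j, (j < 8)%nat /\ 0 < orientation j * k).
  { destruct (Rlt_or_le 0 k); [exists 0%nat|exists 4%nat];
      (split; [lia|]); unfold orientation; cbn; lra. }
  destruct J as (j & hj & hk). destruct (M j hj hk) as (i & hi & E).
  exists (orientation j * k), (compose i j).
  split; [exact hk|]. split; [apply compose_lt|].
  rewrite E, areas_relabel, areas_relabel, Hk, !relabel_scale, !scale_scale.
  rewrite relabel_compose by lia. f_equal.
  unfold orientation at 1. destruct (Nat.ltb_spec i 4); [ring|lia].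
Qed.

(* The areas of the three pieces, where [e1], ..., [e4] are the areas cut off
   from the quadrangle by the lines from [p] to its corners, [l] and [m] the
   positions of [q] and [r]. *)
Lemma closing_areas Av Ab Ac Ad e1 e2 e3 l m x1 x2 x3 x4 x5 :
  Av * e1 = Ad * Av - Ad * e3 - e2 * Av + e2 * Ab ->
  closing (Av, Ab, Ac, Ad) (l * e2, x1, e1, l * Ad)
    (m * e3, x2, x3, (1 - l) * m * Av) (x4, x5, (1 - m) * e3, (1 - m) * Ab) = 0.
Proof.
  intros H. cbv [closing closing_gen].
  transitivity ((1 - m) * m * e3 * Ab * l *
    (Ad * Av - Ad * e3 - e2 * Av + e2 * Ab - Av * e1)); [ring|].
  rewrite <- H; ring.
Qed.

Lemma cut_area v b c d p :
  turn b c d * turn v b p =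
    turn v b c * turn b c d - turn v b c * turn c d p - turn b c p * turn b c d
    + turn b c p * turn c d v /\
  turn b c d * turn d v p =
    turn c d v * turn b c d - turn c d v * turn b c p - turn c d p * turn b c d
    + turn c d p * turn v b c.
Proof. coords; split; ring. Qed.

Lemma piece_areas v b c d p l m :
  let q := between l b c in let r := between m c d in
  areas (v, b, q, p) =
    (l * turn b c p, turn q p v, turn v b p, l * turn v b c) /\
  areas (q, c, r, p) =
    (m * turn c d p, turn r p q, (1 - l) * turn b c p, (1 - l) * m * turn b c d) /\
  areas (r, d, v, p) =
    (turn d v p, turn v p r, (1 - m) * turn c d p, (1 - m) * turn c d v).
Proof.
  intros q r. unfold q, r. clear q r.
  assert (E : forall p q r s p' q' r' s' : R, p = p' -> q = q' -> r = r' -> s = s' ->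
    (p, q, r, s) = (p', q', r', s')) by (intros; subst; reflexivity).
  cbn [areas].
  repeat split; apply E; coords; ring.
Qed.

Lemma pieces_solve v b c d p l m :
  let q := between l b c in let r := between m c d in
  all_positive (areas (v, b, c, d)) -> 0 < l < 1 -> 0 < m < 1 ->
  0 < turn b c p -> 0 < turn c d p ->
  solves (areas (v, b, c, d)) (areas (v, b, q, p)) (areas (q, c, r, p))
         (areas (r, d, v, p)).
Proof.
  intros q r (h1 & h2 & h3 & h4) hl hm k2 k3.
  cbn [areas] in h1, h2, h3, h4.
  destruct (piece_areas v b c d p l m) as (E1 & E2 & E3).
  fold q r in E1, E2, E3. rewrite E1, E2, E3. clear E1 E2 E3.
  destruct (cut_area v b c d p) as (F1 & F2).
  cbn [areas]. split; [|split; [|split]].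
  - apply closing_areas, F1.
  - cbn [relabel].
    pose proof (closing_areas _ _ (turn d v b) _ _ _ _ (1 - m) (1 - l)
      (turn v p r) (turn r p q) (m * turn c d p) (turn v b p) (turn q p v) F2) as C.
    replace (1 - (1 - m)) with m in C by ring.
    replace (1 - (1 - l)) with l in C by ring.
    replace (m * (1 - l)) with ((1 - l) * m) in C by ring. exact C.
  - cbv [margin margin_gen].
    match goal with |- 0 < ?T => replace T with
      ((1 - m) * m * turn c d p * turn b c d * turn c d v * l) by ring end.
    repeat apply Rmult_lt_0_compat; lra.
  - cbv [margin margin_gen relabel].
    match goal with |- 0 < ?T => replace T with
      ((1 - l) * l * turn b c p * turn b c d * turn v b c * (1 - m)) by ring end.
    repeat apply Rmult_lt_0_compat; lra.
Qed.

Lemma open_segment_reverse a b z : open_segment a b z -> open_segment b a z.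
Proof.
  intros (t & ht & ->). exists (1 - t). split; [lra|].
  unfold between. f_equal; ring.
Qed.

Lemma forward_positive Q P1 P2 P3 v b c d p q r :
  same_region Q (hull4 v b c d) -> all_positive (areas (v, b, c, d)) ->
  interior2 Q p -> open_segment b c q -> open_segment c d r ->
  same_region P1 (sector p v b q) -> same_region P2 (sector p q c r) ->
  same_region P3 (sector p r d v) ->
  affine_image Q P1 -> affine_image Q P2 -> affine_image Q P3 ->
  exists i j k, (i < 8)%nat /\ (j < 8)%nat /\ (k < 8)%nat /\
    solves (areas (v, b, c, d)) (relabel i (areas (v, b, c, d)))
      (relabel j (areas (v, b, c, d))) (relabel k (areas (v, b, c, d))).
Proof.
  intros HQ HA HI (l & hl & ->) (m & hm & ->) S1 S2 S3 I1 I2 I3.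
  pose proof HA as (h1 & h2 & h3 & h4). cbn [areas] in h1, h2, h3, h4.
  assert (N : forall x y z : point, 0 < turn x y z -> x <> y /\ y <> z /\ z <> x).
  { clear. intros x y z H.
    repeat split; intros ->; revert H; coords; lra. }
  assert (HQ' : forall y, Q y -> _) by (intros y Hy; apply HQ in Hy;
    exact (proj1 (hull4_halfplanes _ _ _ _ y HA) Hy)).
  assert (k1 : 0 < turn v b p)
    by (apply (interior_halfplane Q); [apply HQ'|apply (N _ _ _ h4)|exact HI]).
  assert (k2 : 0 < turn b c p)
    by (apply (interior_halfplane Q); [apply HQ'|apply (N _ _ _ h1)|exact HI]).
  assert (k3 : 0 < turn c d p)
    by (apply (interior_halfplane Q); [apply HQ'|apply (N _ _ _ h2)|exact HI]).
  assert (k4 : 0 < turn d v p)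
    by (apply (interior_halfplane Q); [apply HQ'|apply (N _ _ _ h3)|exact HI]).
  set (q := between l b c) in *. set (r := between m c d) in *.
  destruct (piece_areas v b c d p l m) as (E1 & E2 & E3).
  fold q r in E1, E2, E3.
  injection E1 as E11 E13 E14. injection E2 as E21 E23 E24.
  injection E3 as E33 E34.
  assert (Mp : forall x y, 0 < x -> 0 < y -> 0 < x * y) by (intros; nra).
  destruct (areas_of_affine_sector Q P1 v b c d v b q p) as (x1 & i1 & px1 & hi1 & X1);
    trivial.
  { rewrite E14; nra. } { rewrite E13; exact k1. }
  { rewrite E11; nra. }
  destruct (areas_of_affine_sector Q P2 v b c d q c r p) as (x2 & i2 & px2 & hi2 & X2);
    trivial.
  { rewrite E24. repeat apply Mp; lra. } { rewrite E23. apply Mp; lra. }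
  { rewrite E21. apply Mp; lra. }
  destruct (areas_of_affine_sector Q P3 v b c d r d v p) as (x3 & i3 & px3 & hi3 & X3);
    trivial.
  { rewrite E34. apply Mp; lra. } { rewrite E33. apply Mp; lra. }
  pose proof (pieces_solve v b c d p l m HA hl hm k2 k3) as S.
  fold q r in S. rewrite X1, X2, X3 in S.
  exists i1, i2, i3. repeat (split; [assumption|]).
  apply (solves_scale 1 x1 x2 x3); try assumption; [lra|].
  replace (scale 1 (areas (v, b, c, d))) with (areas (v, b, c, d)); [exact S|].
  cbn [areas scale]. rewrite !Rmult_1_l. reflexivity.
Qed.

(** * From labels to a dissection *)

Lemma hull4_subset a b c d w x y z e : all_positive (areas (a, b, c, d)) ->
  hull4 a b c d w -> hull4 a b c d x -> hull4 a b c d y -> hull4 a b c d z ->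
  hull4 w x y z e -> hull4 a b c d e.
Proof.
  intros HA hw hx hy hz H.
  apply (hull4_halfplanes _ _ _ _ _ HA) in hw as (? & ? & ? & ?).
  apply (hull4_halfplanes _ _ _ _ _ HA) in hx as (? & ? & ? & ?).
  apply (hull4_halfplanes _ _ _ _ _ HA) in hy as (? & ? & ? & ?).
  apply (hull4_halfplanes _ _ _ _ _ HA) in hz as (? & ? & ? & ?).
  apply (hull4_halfplanes _ _ _ _ _ HA).
  repeat split; apply (hull4_halfplane w x y z); assumption.
Qed.

Lemma hull4_between a b c d l : 0 <= l <= 1 ->
  hull4 a b c d (between l b c) /\ hull4 a b c d (between l c d).
Proof.
  intros hl. split.
  - exists 0, (1 - l), l, 0. repeat (split; [lra|]). unfold between; f_equal; ring.
  - exists 0, 0, (1 - l), l. repeat (split; [lra|]). unfold between; f_equal; ring.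
Qed.

(* The three rays from [p] surround it, so at each point the three signed areas
   [turn p v z], [turn p q z], [turn p r z] cannot all have the same strict sign;
   consecutive ones of opposite signs tell in which piece the point lies. *)
Lemma pieces_cover v b c d p l m z :
  let q := between l b c in let r := between m c d in
  0 < l < 1 -> 0 < m < 1 -> all_positive (areas (v, b, c, d)) ->
  all_positive (areas (v, b, q, p)) -> all_positive (areas (q, c, r, p)) ->
  all_positive (areas (r, d, v, p)) -> hull4 v b c d z ->
  hull4 v b q p z \/ hull4 q c r p z \/ hull4 r d v p z.
Proof.
  intros q r hl hm HA A1 A2 A3 H.
  apply (hull4_halfplanes _ _ _ _ _ HA) in H as (h1 & h2 & h3 & h4).
  rewrite (hull4_halfplanes _ _ _ _ _ A1), (hull4_halfplanes _ _ _ _ _ A2),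
    (hull4_halfplanes _ _ _ _ _ A3).
  assert (S : forall x, turn x p z = - turn p x z) by (intros; coords; ring).
  rewrite !S.
  assert (Eb : turn b q z = l * turn b c z /\ turn q c z = (1 - l) * turn b c z)
    by (unfold q; clear; coords; split; ring).
  assert (Ec : turn c r z = m * turn c d z /\ turn r d z = (1 - m) * turn c d z)
    by (unfold r; clear; coords; split; ring).
  destruct Eb as [-> ->], Ec as [-> ->].
  assert (D : turn r p q * turn p v z + turn v p r * turn p q z
              + turn q p v * turn p r z = 0) by (clear; coords; ring).
  cbn [areas] in A1, A2, A3.
  destruct A1 as (_ & w3 & _ & _), A2 as (_ & w1 & _ & _), A3 as (_ & w2 & _ & _).
  assert (M : forall x y, 0 < x -> 0 < y -> 0 < x * y) by (intros; nra).
  assert (N : forall x y, 0 < x -> y < 0 -> x * y < 0) by (intros; nra).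
  assert (L : forall x y, 0 <= x -> 0 <= y -> 0 <= x * y) by (intros; nra).
  pose proof (L l (turn b c z) ltac:(lra) h2).
  pose proof (L (1 - l) (turn b c z) ltac:(lra) h2).
  pose proof (L m (turn c d z) ltac:(lra) h3).
  pose proof (L (1 - m) (turn c d z) ltac:(lra) h3).
  destruct (Rle_or_lt 0 (turn p v z)) as [sv|sv];
    destruct (Rle_or_lt 0 (turn p q z)) as [sq|sq];
    destruct (Rle_or_lt 0 (turn p r z)) as [sr|sr];
    try (left; lra); try (right; left; lra); try (right; right; lra).
  - destruct (Req_dec (turn p v z) 0); [right; right; lra|].
    destruct (Req_dec (turn p q z) 0); [left; lra|].
    destruct (Req_dec (turn p r z) 0); [right; left; lra|].
    exfalso.
    pose proof (M _ (turn p v z) w1 ltac:(lra)).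
    pose proof (M _ (turn p q z) w2 ltac:(lra)).
    pose proof (M _ (turn p r z) w3 ltac:(lra)). lra.
  - exfalso.
    pose proof (N _ _ w1 sv). pose proof (N _ _ w2 sq). pose proof (N _ _ w3 sr).
    lra.
Qed.

Lemma opposite_halfplanes_disjoint A B a b : a <> b ->
  (forall z, A z -> 0 <= turn a b z) -> (forall z, B z -> 0 <= turn b a z) ->
  interiors_disjoint A B.
Proof.
  intros ne HA HB z [IA IB].
  apply (interior_halfplane A a b) in IA; trivial.
  apply (interior_halfplane B b a) in IB; auto.
  revert IA IB. coords; lra.
Qed.

Lemma strict_halfplanes_interior Q a b c d p :
  same_region Q (hull4 a b c d) -> all_positive (areas (a, b, c, d)) ->
  0 < turn a b p -> 0 < turn b c p -> 0 < turn c d p -> 0 < turn d a p ->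
  interior2 Q p.
Proof.
  intros HQ HA h1 h2 h3 h4. unfold interior2.
  generalize (filter_and _ _ (halfplane_interior _ _ _ h1) (filter_and _ _
    (halfplane_interior _ _ _ h2) (filter_and _ _ (halfplane_interior _ _ _ h3)
      (halfplane_interior _ _ _ h4)))).
  apply filter_imp. intros y H. apply HQ, (hull4_halfplanes _ _ _ _ _ HA). lra.
Qed.

Lemma relabel_sum i a b c d : a + c = b + d ->
  let '(a', b', c', d') := relabel i (a, b, c, d) in a' + c' = b' + d'.
Proof.
  intros H. do 8 (destruct i as [|i]; [cbn; lra|]). cbn; lra.
Qed.

(** All parameters are forced by proportionality: [e2] by the first piece, [e3] by the third, then
    [l] and [m] by the middle one. The two proportions left over, [t1] and [t4], are the closing
    equations, and the margins give [0 < l] and [m < 1]. *)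
Lemma realize_positive Q v b c d i j k :
  same_region Q (hull4 v b c d) -> all_positive (areas (v, b, c, d)) ->
  (i < 8)%nat -> (j < 8)%nat -> (k < 8)%nat ->
  solves (areas (v, b, c, d)) (relabel i (areas (v, b, c, d)))
    (relabel j (areas (v, b, c, d))) (relabel k (areas (v, b, c, d))) ->
  admits_self_affinity3_C Q.
Proof.
  intros HQ HA hi hj hk HS.
  pose proof HA as (h1 & h2 & h3 & h4). cbn [areas] in h1, h2, h3, h4.
  set (A := areas (v, b, c, d)) in *.
  pose proof (all_positive_relabel i A HA) as Pa.
  pose proof (all_positive_relabel j A HA) as Pb.
  pose proof (all_positive_relabel k A HA) as Pg.
  pose proof (areas_sum v b c d) as HSum.
  pose proof (relabel_sum i _ _ _ _ HSum) as Sa.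
  pose proof (relabel_sum j _ _ _ _ HSum) as Sb.
  pose proof (relabel_sum k _ _ _ _ HSum) as Sg.
  change (turn b c d, turn c d v, turn d v b, turn v b c) with A in Sa, Sb, Sg.
  destruct (relabel i A) as [[[av ab] aq] ap] eqn:Ea.
  destruct (relabel j A) as [[[bq bc] br] bp] eqn:Eb.
  destruct (relabel k A) as [[[gr gd] gv] gp] eqn:Eg.
  destruct Pa as (pa1 & pa2 & pa3 & pa4), Pb as (pb1 & pb2 & pb3 & pb4),
    Pg as (pg1 & pg2 & pg3 & pg4).
  unfold A in HS. cbn [areas] in HS.
  cbv [solves closing closing_gen margin margin_gen relabel] in HS.
  destruct HS as (Z1 & Z2 & I1 & I2).
  set (Av := turn b c d) in *. set (Ab := turn c d v) in *.
  set (Ad := turn v b c) in *.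
  set (e2 := Ad * av / ap). set (e3 := Ab * gv / gp).
  set (l := 1 - e3 * bp / (Av * bq)). set (m := e2 * bp / (Av * br)).
  (* The point with areas [e2] over [b]-[c] and [e3] over [c]-[d], in barycentric coordinates of the
     triangle [b], [c], [d]. *)
  set (p := ((1 - e3 / Av - e2 / Av) * fst c + e3 / Av * fst b + e2 / Av * fst d,
             (1 - e3 / Av - e2 / Av) * snd c + e3 / Av * snd b + e2 / Av * snd d)).
  assert (P : forall x y, 0 < x -> 0 < y -> 0 < x * y)
    by (intros; apply Rmult_lt_0_compat; assumption).
  assert (pe2 : 0 < e2) by (apply Rdiv_lt_0_compat; auto).
  assert (pe3 : 0 < e3) by (apply Rdiv_lt_0_compat; auto).
  assert (hl : 0 < l < 1).
  { split.
    - replace l with ((Av * gp * bq - Ab * gv * bp) / (Av * gp * bq))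
        by (unfold l, e3; field; lra).
      apply Rdiv_lt_0_compat; auto.
    - assert (0 < e3 * bp / (Av * bq)) by (apply Rdiv_lt_0_compat; auto).
      unfold l; lra. }
  assert (hm : 0 < m < 1).
  { split.
    - apply Rdiv_lt_0_compat; auto.
    - assert (0 < 1 - m); [|lra].
      replace (1 - m) with ((Av * ap * br - Ad * av * bp) / (Av * ap * br))
        by (unfold m, e2; field; lra).
      apply Rdiv_lt_0_compat; auto. }
  assert (t2 : turn b c p = e2).
  { assert (nz : Av <> 0) by lra. unfold p. clearbody e2 e3. unfold Av in *.
    clear - nz. coords. field. exact nz. }
  assert (t3 : turn c d p = e3).
  { assert (nz : Av <> 0) by lra. unfold p. clearbody e2 e3. unfold Av in *.
    clear - nz. coords. field. exact nz. }
  destruct (cut_area v b c d p) as (C1 & C4).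
  fold Av Ab Ad in C1, C4. rewrite t2, t3 in C1, C4.
  assert (t1 : ap * turn v b p = l * Ad * aq).
  { apply (Rmult_eq_reg_l (Av * gp * bq)); [|apply Rgt_not_eq; red; auto].
    transitivity (ap * gp * bq * (Av * turn v b p)); [ring|]. rewrite C1.
    match type of Z1 with ?z = 0 =>
      transitivity (Av * gp * bq * (l * Ad * aq) + Ad * z);
      [unfold l, e2, e3; field; lra|rewrite Z1; ring] end. }
  assert (t4 : gp * turn d v p = (1 - m) * Ab * gr).
  { apply (Rmult_eq_reg_l (Av * ap * br)); [|apply Rgt_not_eq; red; auto].
    transitivity (gp * ap * br * (Av * turn d v p)); [ring|]. rewrite C4.
    match type of Z2 with ?z = 0 =>
      transitivity (Av * ap * br * ((1 - m) * Ab * gr) + Ab * z);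
      [unfold m, e2, e3; field; lra|rewrite Z2; ring] end. }
  set (q := between l b c). set (r := between m c d).
  destruct (piece_areas v b c d p l m) as (E1 & E2 & E3). fold q r in E1, E2, E3.
  fold Av Ab Ad in E1, E2, E3. rewrite t2 in E1, E2. rewrite t3 in E2, E3.
  (* The second entry of each piece comes for free from the equal sums of opposite entries. *)
  assert (quad_eq : forall w x y z w' x' y' z' : R, w = w' -> y = y' -> z = z' ->
      w + y = x + z -> w' + y' = x' + z' -> (w, x, y, z) = (w', x', y', z')).
  { intros. subst. replace x with x' by lra. reflexivity. }
  assert (K1 : areas (v, b, q, p) = scale (l * Ad / ap) (av, ab, aq, ap)).
  { pose proof (areas_sum v b q p) as HS1. cbn [areas] in E1 |- *.
    injection E1 as F1 F3 F4. rewrite F1, F3, F4 in *.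
    cbn [scale]. apply quad_eq; [unfold e2; field; lra| |field; lra|exact HS1|].
    - apply (Rmult_eq_reg_l ap); [rewrite t1; field|]; lra.
    - rewrite <- !Rmult_plus_distr_l, Sa. reflexivity. }
  assert (K2 : areas (q, c, r, p) = scale (m * e3 / bq) (bq, bc, br, bp)).
  { pose proof (areas_sum q c r p) as HS1. cbn [areas] in E2 |- *.
    injection E2 as F1 F3 F4. rewrite F1, F3, F4 in *.
    assert (L1 : (1 - l) * Av = e3 * bp / bq) by (unfold l; field; lra).
    cbn [scale]. apply quad_eq; [field; lra| | |exact HS1|].
    - apply (Rmult_eq_reg_l Av); [|lra].
      transitivity ((1 - l) * Av * e2); [ring|]. rewrite L1.
      unfold m; field; lra.
    - transitivity (m * ((1 - l) * Av)); [ring|]. rewrite L1. field; lra.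
    - rewrite <- !Rmult_plus_distr_l, Sb. reflexivity. }
  assert (K3 : areas (r, d, v, p) = scale ((1 - m) * Ab / gp) (gr, gd, gv, gp)).
  { pose proof (areas_sum r d v p) as HS1. cbn [areas] in E3 |- *.
    injection E3 as F3 F4. rewrite F3, F4 in *.
    cbn [scale]. apply quad_eq; [|unfold e3; field; lra|field; lra|exact HS1|].
    - apply (Rmult_eq_reg_l gp); [rewrite t4; field|]; lra.
    - rewrite <- !Rmult_plus_distr_l, Sg. reflexivity. }
  rewrite <- Ea in K1. rewrite <- Eb in K2. rewrite <- Eg in K3.
  assert (pk1 : 0 < l * Ad / ap) by (apply Rdiv_lt_0_compat; [apply P|]; lra).
  assert (pk2 : 0 < m * e3 / bq) by (apply Rdiv_lt_0_compat; [apply P|]; lra).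
  assert (pk3 : 0 < (1 - m) * Ab / gp) by (apply Rdiv_lt_0_compat; [apply P|]; lra).
  assert (A1 : all_positive (areas (v, b, q, p)))
    by (rewrite K1; apply all_positive_scale, all_positive_relabel, HA; exact pk1).
  assert (A2 : all_positive (areas (q, c, r, p)))
    by (rewrite K2; apply all_positive_scale, all_positive_relabel, HA; exact pk2).
  assert (A3 : all_positive (areas (r, d, v, p)))
    by (rewrite K3; apply all_positive_scale, all_positive_relabel, HA; exact pk3).
  pose proof (sector_hull p v b q A1) as S1.
  pose proof (sector_hull p q c r A2) as S2.
  pose proof (sector_hull p r d v A3) as S3.
  assert (k1 : 0 < turn v b p)
    by (rewrite (turn_cycle p v b); apply A1).
  assert (k4 : 0 < turn d v p) by apply A3.
  assert (Ip : interior2 Q p)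
    by (apply (strict_halfplanes_interior Q v b c d p HQ HA); lra).
  assert (Hp : hull4 v b c d p).
  { apply (hull4_halfplanes _ _ _ _ _ HA). lra. }
  destruct (hull4_vertices v b c d) as (Hv & Hb & Hc & Hd).
  destruct (hull4_between v b c d l ltac:(lra)) as [Hq _]. fold q in Hq.
  destruct (hull4_between v b c d m ltac:(lra)) as [_ Hr]. fold r in Hr.
  assert (N : forall x y z : point, 0 < turn x y z -> x <> y /\ y <> z /\ z <> x).
  { clear. intros x y z H.
    repeat split; intros ->; revert H; coords; lra. }
  exists (sector p v b q), (sector p q c r), (sector p r d v).
  split; [split; [|split]|].
  - assert (HQ' : same_region Q (hull (v, b, c, d))) by exact HQ.
    assert (T : forall B w i k, same_region B (hull w) -> 0 < k -> (i < 8)%nat ->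
        areas w = scale k (relabel i A) -> affine_image Q B).
    { intros B w i0 k0 HB hk0 hi0 HE.
      destruct (affine_image_of_areas Q _ w i0 k0 HQ' HA hk0 hi0 HE) as (f & Hf & HF).
      exists f. split; [exact Hf|]. exact (same_region_trans _ _ _ HB HF). }
    split; [|split].
    + exact (T _ (v, b, q, p) i _ S1 pk1 hi K1).
    + exact (T _ (q, c, r, p) j _ S2 pk2 hj K2).
    + exact (T _ (r, d, v, p) k _ S3 pk3 hk K3).
  - intros z. rewrite (S1 z), (S2 z), (S3 z), (HQ z). split.
    + apply (pieces_cover v b c d p l m z hl hm HA A1 A2 A3).
    + intros [H|[H|H]]; revert H; apply (hull4_subset _ _ _ _ _ _ _ _ _ HA); assumption.
  - assert (X1 : forall z, sector p v b q z -> 0 <= turn q p z /\ 0 <= turn p v z).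
    { intros z Hz. apply S1, (hull4_halfplanes _ _ _ _ _ A1) in Hz. tauto. }
    assert (X2 : forall z, sector p q c r z -> 0 <= turn r p z /\ 0 <= turn p q z).
    { intros z Hz. apply S2, (hull4_halfplanes _ _ _ _ _ A2) in Hz. tauto. }
    assert (X3 : forall z, sector p r d v z -> 0 <= turn v p z /\ 0 <= turn p r z).
    { intros z Hz. apply S3, (hull4_halfplanes _ _ _ _ _ A3) in Hz. tauto. }
    assert (nq : q <> p) by apply (N _ _ _ (proj1 (proj2 A1))).
    assert (nr : r <> p) by apply (N _ _ _ (proj1 (proj2 A2))).
    assert (nv : v <> p) by apply (N _ _ _ (proj1 (proj2 A3))).
    split; [|split].
    + apply (opposite_halfplanes_disjoint _ _ q p nq); intros z Hz;
        [apply X1|apply X2]; exact Hz.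
    + apply (opposite_halfplanes_disjoint _ _ r p nr); intros z Hz;
        [apply X2|apply X3]; exact Hz.
    + apply (opposite_halfplanes_disjoint _ _ v p nv); intros z Hz;
        [apply X3|apply X1]; exact Hz.
  - exists v, b, c, d, p, q, r.
    split; [split; [left; exact (conj h4 (conj h1 (conj h2 h3)))|exact HQ]|].
    split; [exact Ip|]. split; [exists l; split; [exact hl|reflexivity]|].
    split; [exists m; split; [exact hm|reflexivity]|].
    repeat split; auto.
Qed.

(** * The equivalence *)

Lemma scale_1 w : scale 1 w = w.
Proof. destruct w as [[[? ?] ?] ?]; cbn [scale]. rewrite !Rmult_1_l. reflexivity. Qed.

Lemma self_affinity_labels Q : admits_self_affinity3_C Q ->
  exists v b c d i j k,
    same_region Q (hull4 v b c d) /\ all_positive (areas (v, b, c, d)) /\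
    (i < 8)%nat /\ (j < 8)%nat /\ (k < 8)%nat /\
    solves (areas (v, b, c, d)) (relabel i (areas (v, b, c, d)))
      (relabel j (areas (v, b, c, d))) (relabel k (areas (v, b, c, d))).
Proof.
  intros (P1 & P2 & P3 & ((I1 & I2 & I3) & _) & v & b & c & d & p & q & r &
          [C HQ] & HI & hq & hr & S1 & S2 & S3).
  destruct C as [(h1 & h2 & h3 & h4)|(h1 & h2 & h3 & h4)].
  - exists v, b, c, d.
    assert (HA : all_positive (areas (v, b, c, d))) by (cbn; tauto).
    destruct (forward_positive Q P1 P2 P3 v b c d p q r) as (i & j & k & H);
      trivial. exists i, j, k. tauto.
  (* A clockwise quadrangle is listed backwards, which also exchanges [q] with [r] and [P1] with
     [P3]. *)
  - exists v, d, c, b.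
    assert (HA : all_positive (areas (v, d, c, b)))
      by (clear - h1 h2 h3 h4; cbn; coords; repeat split; lra).
    assert (HQ' : same_region Q (hull4 v d c b)).
    { apply same_region_trans with (1 := HQ), same_region_sym.
      exact (hull_relabel 4 (v, b, c, d)). }
    destruct (forward_positive Q P3 P2 P1 v d c b p r q) as (i & j & k & H);
      trivial; try (apply open_segment_reverse; assumption);
      try (eapply same_region_trans; [eassumption|apply sector_reverse]).
    exists i, j, k. tauto.
Qed.

(** Two triangles over the common side [a]-[b] have equal areas when [c]-[d] is parallel to it; so a
    quadrangle with two equal neighbouring entries is a trapezoid. *)
Lemma parallel_sides a b c d :
  cross (vec a b) (vec c d) = turn d a b - turn a b c.
Proof. coords; ring. Qed.

(** A rotation puts the largest entry last and a reflection arranges [c <= a]. The equal sums make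
    the entry opposite to the largest one smallest, and give [c - b = d - a > 0]. *)
Lemma sort_areas (A B C D : R) : all_positive (A, B, C, D) -> A + C = B + D ->
  C <> D -> D <> A -> exists g a b c d, (g < 8)%nat /\
    relabel g (A, B, C, D) = (a, b, c, d) /\ 0 < b /\ b < c /\ c <= a /\ a < d /\
    a + c = b + d.
Proof.
  intros (hA & hB & hC & hD) S n1 n2.
  assert (T : forall g a b c d, (g < 8)%nat ->
    relabel g (A, B, C, D) = (a, b, c, d) ->
    0 < b /\ b < c /\ c <= a /\ a < d /\ a + c = b + d ->
    exists g a b c d, (g < 8)%nat /\
    relabel g (A, B, C, D) = (a, b, c, d) /\ 0 < b /\ b < c /\ c <= a /\ a < d /\
    a + c = b + d).
  { intros g a b c d hg E H. exists g, a, b, c, d. tauto. }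
  destruct (Rle_or_lt C A); destruct (Rle_or_lt D B);
    destruct (Rle_or_lt D A); destruct (Rle_or_lt D C).
  all: first
    [ exfalso; lra
    | apply (T 0%nat A B C D); [lia|reflexivity|lra]
    | apply (T 1%nat B C D A); [lia|reflexivity|lra]
    | apply (T 2%nat C D A B); [lia|reflexivity|lra]
    | apply (T 3%nat D A B C); [lia|reflexivity|lra]
    | apply (T 4%nat A D C B); [lia|reflexivity|lra]
    | apply (T 5%nat B A D C); [lia|reflexivity|lra]
    | apply (T 6%nat C B A D); [lia|reflexivity|lra]
    | apply (T 7%nat D C B A); [lia|reflexivity|lra] ].
Qed.

Definition standard_quad (x y : R) : quad point := ((0, 1), (0, 0), (1, 0), (x, y)).

Lemma areas_standard x y : areas (standard_quad x y) = standard x y.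
Proof.
  unfold standard; cbn. unfold turn, cross, vec; cbn [fst snd].
  f_equal; [f_equal; [f_equal|]|]; ring.
Qed.

Lemma forward Q : ~ trapezoid Q -> admits_self_affinity3_C Q ->
  exists x y, affine_type Q x y /\ listed x y.
Proof.
  intros NT H.
  destruct (self_affinity_labels Q H)
    as (v & b & c & d & i & j & k & HQ & HA & hi & hj & hk & HS).
  pose proof (areas_sum v b c d) as HSum.
  pose proof HA as (h1 & h2 & h3 & h4). cbn [areas] in h1, h2, h3, h4.
  assert (n1 : turn d v b <> turn v b c).
  { intros E. apply NT. exists v, b, c, d. split; [split|].
    - left; unfold convex_cycle; tauto.
    - exact HQ.
    - rewrite parallel_sides; lra. }
  assert (n2 : turn v b c <> turn b c d).
  { intros E. apply NT. exists b, c, d, v. split; [split|].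
    - left; unfold convex_cycle; tauto.
    - apply same_region_trans with (1 := HQ), same_region_sym.
      exact (hull_relabel 1 (v, b, c, d)).
    - rewrite parallel_sides; lra. }
  destruct (sort_areas _ _ _ _ HA HSum n1 n2)
    as (g & a' & b' & c' & d' & hg & Eg & k1 & k2 & k3 & k4 & k5).
  set (A := areas (v, b, c, d)) in *. change (relabel g A = (a', b', c', d')) in Eg.
  destruct (relabel_inverse g hg) as (h & hh & Hinv).
  (* Dividing by the largest entry turns the sorted vector into [standard x y]. *)
  set (x := c' / d'). set (y := a' / d').
  assert (W : (a', b', c', d') = scale d' (standard x y)).
  { unfold standard, scale, x, y.
    replace b' with (d' * (c' / d' + a' / d' - 1)) by (field_simplify; lra).
    f_equal; [f_equal; [f_equal|]|]; field; lra. }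
  assert (EA : A = scale d' (relabel h (standard x y))).
  { rewrite <- relabel_scale, <- W, <- Eg. symmetry. apply Hinv. }
  assert (hxy : in_P x y /\ y < 1).
  { assert (d' * x = c') by (unfold x; field; lra).
    assert (d' * y = a') by (unfold y; field; lra).
    unfold in_P. repeat split; apply Rnot_le_lt || apply Rnot_lt_le; intro; nra. }
  exists x, y. split.
  - destruct (affine_map_of_areas (v, b, c, d) (relabel h (standard_quad x y))
      (orientation h / d')) as (f & Hf & Mf).
    + unfold orientation. destruct (h <? 4)%nat; intros E;
        apply (f_equal (Rmult d')) in E; unfold Rdiv in E;
        rewrite <- Rmult_assoc, (Rmult_comm d'), Rmult_assoc, Rinv_r in E; lra.
    + exact HA.
    + rewrite areas_relabel, areas_standard. fold A. rewrite EA, scale_scale.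
      f_equal. field. lra.
    + assert (M : forall S T (f : S -> T) i u,
        map_quad f (relabel i u) = relabel i (map_quad f u)).
      { clear. intros S T f i [[[? ?] ?] ?].
        do 8 (destruct i as [|i]; [reflexivity|]). reflexivity. }
      pose proof (hull_relabel g (v, b, c, d)) as HU.
      pose proof (areas_relabel g (v, b, c, d)) as AU. fold A in AU.
      rewrite Eg in AU.
      assert (MU : map_quad f (relabel g (v, b, c, d)) = standard_quad x y)
        by (rewrite M, Mf; apply Hinv).
      destruct (relabel g (v, b, c, d)) as [[[a0 b0] c0] d0].
      exists a0, b0, c0, d0, f.
      injection MU as M1 M2 M3 M4.
      split; [split|tauto].
      * cbn [areas scale] in AU. injection AU as U1 U2 U3 U4. unfold convex_cycle.
        rewrite U1, U2, U3, U4. unfold orientation.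
        destruct (g <? 4)%nat; [left|right]; lra.
      * apply same_region_trans with (1 := HQ), same_region_sym, HU.
  - apply (solves_listed x y h (compose i h) (compose j h) (compose k h));
      try apply compose_lt; try tauto.
    rewrite <- !relabel_compose by assumption.
    apply (solves_scale d' d' d' d'); try lra.
    rewrite <- !relabel_scale, relabel_scale, <- EA. exact HS.
Qed.

Lemma realize_standard Q w k x y g0 g1 g2 g3 :
  same_region Q (hull w) -> areas w = scale k (standard x y) ->
  0 < orientation g0 * k -> all_positive (standard x y) ->
  (g0 < 8)%nat -> (g1 < 8)%nat -> (g2 < 8)%nat -> (g3 < 8)%nat ->
  solves (relabel g0 (standard x y)) (relabel g1 (standard x y))
         (relabel g2 (standard x y)) (relabel g3 (standard x y)) ->
  admits_self_affinity3_C Q.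
Proof.
  intros HQ EA hk HP h0 h1 h2 h3 HS.
  destruct (relabel_inverse g0 h0) as (h & hh & Hinv).
  pose proof (hull_relabel g0 w) as HU.
  pose proof (areas_relabel g0 w) as AU. rewrite EA, relabel_scale, scale_scale in AU.
  set (s := orientation g0 * k) in *.
  assert (E : forall i, (i < 8)%nat -> relabel (compose i h) (areas (relabel g0 w))
                      = scale s (relabel i (standard x y))).
  { intros i hi. rewrite AU, relabel_scale, <- relabel_compose by assumption.
    do 2 f_equal. apply Hinv. }
  destruct (relabel g0 w) as [[[v b] c] d].
  apply (realize_positive Q v b c d (compose g1 h) (compose g2 h) (compose g3 h));
    try apply compose_lt.
  - apply same_region_trans with (1 := HQ), same_region_sym, HU.
  - rewrite AU. apply all_positive_scale; [exact hk|].
    apply all_positive_relabel, HP.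
  - rewrite !E, AU by assumption. apply solves_scale; assumption.
Qed.

Lemma backward Q x y : affine_type Q x y -> listed x y -> admits_self_affinity3_C Q.
Proof.
  intros (a & b & c & d & f & [_ HQ] & Hf & M1 & M2 & M3 & M4) HL.
  destruct (listed_solves x y HL)
    as (HP & hy & g0 & g1 & g2 & g3 & h0 & h1 & h2 & h3 & HS).
  destruct (areas_affine f Hf) as (k & nk & Hk).
  assert (EA : areas (a, b, c, d) = scale (/ k) (standard x y)).
  { rewrite <- areas_standard. unfold standard_quad.
    rewrite <- M1, <- M2, <- M3, <- M4.
    change (areas (a, b, c, d) = scale (/ k) (areas (map_quad f (a, b, c, d)))).
    rewrite Hk, scale_scale, Rinv_l, scale_1 by exact nk. reflexivity. }
  assert (PA : all_positive (standard x y))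
    by (unfold in_P in HP; cbn; repeat split; lra).
  assert (nk' : / k <> 0) by (apply Rinv_neq_0_compat; exact nk).
  destruct (Rlt_or_le 0 (orientation g0 * / k)) as [L|L].
  - exact (realize_standard Q (a, b, c, d) (/ k) x y g0 g1 g2 g3 HQ EA L PA
             h0 h1 h2 h3 HS).
  (* If the label lists the corners clockwise, the mirrored label has the opposite orientation. *)
  - apply solves_mirror in HS. rewrite !relabel_compose in HS by lia.
    apply (realize_standard Q (a, b, c, d) (/ k) x y _ _ _ _ HQ EA) in HS;
      try apply compose_lt; try assumption.
    assert (O : orientation (compose 4 g0) = - orientation g0).
    { unfold orientation.
      do 8 (destruct g0 as [|g0]; [cbn; lra|]). lia. }
    rewrite O. unfold orientation in *. destruct (g0 <? 4)%nat; lra.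
Qed.

(* In most of the systems (1,1) is a further solution in P; it parametrizes the
   square, a trapezoid, and is set aside in the uniqueness clause. *)
Theorem theorem6 :
  (forall k : nat, (1 <= k <= 13)%nat ->
     exists x y : R, exceptional k x y /\
       forall x' y' : R, in_P x' y' -> system k x' y' -> (x', y') <> (1, 1) ->
         x' = x /\ y' = y) /\
  (forall x y : R, listed x y -> in_P x y) /\
  (forall Q : point -> Prop, convex_quadrangle Q -> ~ trapezoid Q ->
     (admits_self_affinity3_C Q <->
      exists x y : R, affine_type Q x y /\ listed x y)).
Proof.
  split; [exact systems_solvable|]. split; [exact listed_in_P|].
  intros Q _ NT. split; [exact (forward Q NT)|].
  intros (x & y & HT & HL). exact (backward Q x y HT HL).
Qed.
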